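(* Consider the token-based central queue described in the context, and assume that its assignment rule satisfies the assignment condition and its departure rates satisfy the order-independent condition. Suppose moreover that $$\sum_{i=0}^K\ \sum_{(T_1,\dots,T_i)}\ \sum_{(n_1,\dots,n_i)\in\mathbb N_0^i}\frac{\Pi_\lambda(\{T_1,\dots,T_i\})}{\Pi_k(T_1,\dots,T_i)}\prod_{j=1}^i\alpha_j^{n_j}\prod_{m=1}^{i+\sum_j n_j}\frac1{\eta(m)}<\infty ,$$ where the middle sum runs over ordered tuples of distinct tokens. Then the Markov process on the state space $\mathcal X$ has the stationary distribution $$\pi(x)=\pi((0))\,\frac{\Pi_\lambda(\{T_1,\dots,T_i\})}{\Pi_k(T_1,\dots,T_i)}\,\prod_{j=1}^i\alpha_j^{n_j}\,\prod_{m=1}^{\phi(x)}\frac1{\eta(m)},\qquad x=(T_1,n_1,\dots,T_i,n_i)\in\mathcal X,$$ where $\pi((0))$ is the normalising constant (and the empty state corresponds to $i=0$).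
   Context: Token-based central queue. There is a finite set $\mathcal C$ of customer types; type-$c$ customers arrive according to independent Poisson processes with rates $\lambda_c>0$, and $\lambda=\sum_{c}\lambda_c$. There is a finite set of tokens $\mathcal T=\{t_1,\dots,t_K\}$; each type $c$ has a nonempty set $\mathcal T_c\subseteq\mathcal T$ of compatible tokens, and $\mathcal C_t=\{c: t\in\mathcal T_c\}$. A customer can receive service only while it holds a token (''active''); tokenless customers (''inactive'') wait in a central queue and have departure rate $0$. An arriving type-$c$ customer that finds at least one available token in $\mathcal T_c$ immediately claims one of them according to a randomised assignment rule, whose probabilities may depend on the set of unavailable tokens and on the type; otherwise it waits. When a customer departs, its token is immediately claimed by the longest-waiting tokenless customer whose type lies in $\mathcal C_t$; if there is none, the token becomes available. State descriptor: $(0)$ denotes the empty system; otherwise the state is $x=(T_1,n_1,\dots,T_i,n_i)$, where $T_1,\dots,T_i$ are the distinct currently claimed tokens, listed in the order of arrival of their holders, and $n_j\ge0$ is the number of tokenless customers that arrived after the holder of $T_j$ and before the holder of $T_{j+1}$ ($n_i$ counts those arriving after the holder of $T_i$). $\mathcal X$ is the set of reachable states. For $\mathcal R\subseteq\mathcal T$ let $\mathcal U(\mathcal R)=\{c\in\mathcal C:\mathcal T_c\subseteq\mathcal R\}$ and $\lambda_{\mathcal U(\mathcal R)}=\sum_{c\in\mathcal U(\mathcal R)}\lambda_c$; the $n_j$ customers have types in $\mathcal U(\{T_1,\dots,T_j\})$. For $t\notin\mathcal R$, $\lambda_t(\mathcal R)$ denotes the total rate at which arriving customers claim token $t$ when $\mathcal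 R$ is the set of unavailable tokens. Assignment condition: for every $i\in\{1,\dots,K\}$ and distinct tokens $T_1,\dots,T_i$, the product $\prod_{j=1}^i\lambda_{T_j}(\{T_1,\dots,T_{j-1}\})$ is the same for every permutation of $(T_1,\dots,T_i)$; this common value is denoted $\Pi_\lambda(\{T_1,\dots,T_i\})$, with $\Pi_\lambda(\emptyset)=1$. Order-independent condition: in state $x=(T_1,n_1,\dots,T_i,n_i)$ the departure rate of the holder of $T_j$ is $\eta(\phi(x))\,s_j(T_1,\dots,T_j)$, where $\phi(x)=i+\sum_{j=1}^i n_j$ is the number of customers, each $s_j\ge0$ depends only on $(T_1,\dots,T_j)$, $k(T_1,\dots,T_i):=\sum_{j=1}^i s_j(T_1,\dots,T_j)$ is invariant under permutations of $(T_1,\dots,T_i)$, and $\eta(m)>0$ for $m\ge1$; $k(\emptyset)=0$. It is assumed that $k(T_1,\dots,T_j)>0$ for every nonempty tuple of distinct tokens. Notation: $\Pi_k(T_1,\dots,T_i)=\prod_{j=1}^i k(T_1,\dots,T_j)$ and $\alpha_j=\lambda_{\mathcal U(\{T_1,\dots,T_j\})}/k(T_1,\dots,T_j)$; the convention $0^0=1$ is used. *)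

(* Defs.v *)
From Stdlib Require Import Reals List Permutation Arith.
Import ListNotations.
Open Scope R_scope.

Definition sumR {A : Type} (l : list A) (f : A -> R) : R :=
  fold_right (fun a acc => f a + acc) 0 l.
Definition prodR {A : Type} (l : list A) (f : A -> R) : R :=
  fold_right (fun a acc => f a * acc) 1 l.

(** Unordered sum of a (nonnegative) family over the elements satisfying P:
    S is the supremum of all finite partial sums over duplicate-free lists. *)
Definition nnsum {A : Type} (P : A -> Prop) (f : A -> R) (S : R) : Prop :=
  is_lub (fun r => exists L : list A, NoDup L /\ Forall P L /\ r = sumR L f) S.

Definition memb (t : nat) (l : list nat) : bool := existsb (Nat.eqb t) l.

(** Model data.  Tokens are 0..nK-1, customer types are 0..nC-1.
    [compat c t] : token t is compatible with type c (t in T_c).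
    [lam c]      : arrival rate lambda_c.
    [assign c Rs t] : probability that an arriving type-c customer claims
                      token t when the set of unavailable tokens is (the set
                      of elements of) Rs.
    [srate (T1..Tj)] : s_j(T1,...,Tj).   [eta m] : eta(m). *)
Record model := Model {
  nK : nat;
  nC : nat;
  compat : nat -> nat -> bool;
  lam : nat -> R;
  assign : nat -> list nat -> nat -> R;
  srate : list nat -> R;
  eta : nat -> R
}.

(** State descriptor x = (T1,n1,...,Ti,ni); [] is the empty state (0). *)
Definition state := list (nat * nat).
Definition toks (x : state) : list nat := map fst x.
Definition phi (x : state) : nat :=
  (length x + fold_right (fun e a => snd e + a) 0 x)%nat.

Section WithModel.
Variable M : model.

Definition inU (Rs : list nat) (c : nat) : bool :=
  forallb (fun t => orb (negb (compat M c t)) (memb t Rs)) (seq 0 (nK M)).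
Definition lamU (Rs : list nat) : R :=
  sumR (seq 0 (nC M)) (fun c => if inU Rs c then lam M c else 0).
Definition lamtok (Rs : list nat) (t : nat) : R :=
  sumR (seq 0 (nC M)) (fun c => lam M c * assign M c Rs t).
Definition Pi_lam (l : list nat) : R :=
  prodR (seq 0 (length l)) (fun j => lamtok (firstn j l) (nth j l 0%nat)).
Definition kfun (l : list nat) : R :=
  sumR (seq 1 (length l)) (fun j => srate M (firstn j l)).
Definition Pi_k (l : list nat) : R :=
  prodR (seq 1 (length l)) (fun j => kfun (firstn j l)).
Definition alpha (l : list nat) (j : nat) : R :=
  lamU (firstn j l) / kfun (firstn j l).

Definition weight (x : state) : R :=
  let l := toks x in
  Pi_lam l / Pi_k l
  * prodR (seq 1 (length x)) (fun j => alpha l j ^ (snd (nth (j - 1) x (0%nat, 0%nat))))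
  * prodR (seq 1 (phi x)) (fun m => / eta M m).

(** Customer-sequence representation: Some t = holder of token t,
    None = tokenless (waiting) customer, in order of arrival. *)
Definition to_seq (x : state) : list (option nat) :=
  flat_map (fun e => Some (fst e) :: repeat None (snd e)) x.
Fixpoint incr_last (x : state) : state :=
  match x with
  | [] => []
  | e :: [] => [(fst e, S (snd e))]
  | e :: x' => e :: incr_last x'
  end.
Definition of_seq (sq : list (option nat)) : state :=
  fold_left (fun acc o => match o with
                          | Some t => acc ++ [(t, 0%nat)]
                          | None => incr_last acc end) sq [].
Definition holders (sq : list (option nat)) : list nat :=
  flat_map (fun o => match o with Some t => [t] | None => [] end) sq.

Definition arrivals (x : state) : list (R * state) :=
  flat_map (fun c =>
    if existsb (fun t => andb (compat M c t) (negb (memb t (toks x)))) (seq 0 (nK M))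
    then map (fun t => (lam M c * assign M c (toks x) t, x ++ [(t, 0%nat)]))
             (seq 0 (nK M))
    else [(lam M c, incr_last x)]) (seq 0 (nC M)).

(** Probability that a waiting customer, preceded by the holders in [pre]
    (other than the freed token T), is NOT compatible with the freed token T:
    conditionally on the state its type c lies in U(pre u {T}) with
    probability proportional to lambda_c, and it is incompatible with T iff
    c lies in U(pre). *)
Definition qpass (T : nat) (pre : list (option nat)) : R :=
  let R1 := holders pre in
  let U := lamU (T :: R1) in
  if Req_EM_T U 0 then 1 else lamU R1 / U.

Definition passf (T : nat) (s1 s2 : list (option nat)) (r : nat) : R :=
  match nth r s2 (Some 0%nat) with
  | None => qpass T (s1 ++ firstn r s2)
  | Some _ => 1
  end.

(** Departures: the holder of T_j leaves at rate eta(phi x) s_j(T_1..T_j);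
    its token goes to the longest-waiting compatible tokenless customer
    (which then holds it, at its own position in the arrival order), or
    becomes available if there is none. *)
Definition departures (x : state) : list (R * state) :=
  flat_map (fun j0 =>
    let T := nth j0 (toks x) 0%nat in
    let base := eta M (phi x) * srate M (firstn (S j0) (toks x)) in
    let s1 := to_seq (firstn j0 x) in
    let s2 := repeat None (snd (nth j0 x (0%nat, 0%nat))) ++ to_seq (skipn (S j0) x) in
    let pp r := prodR (seq 0 r) (passf T s1 s2) in
    (base * pp (length s2), of_seq (s1 ++ s2)) ::
    flat_map (fun r =>
      match nth r s2 (Some 0%nat) with
      | None => [(base * pp r * (1 - qpass T (s1 ++ firstn r s2)),
                  of_seq (s1 ++ firstn r s2 ++ Some T :: skipn (S r) s2))]
      | Some _ => []
      end) (seq 0 (length s2)))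
   (seq 0 (length x)).

Definition transitions (x : state) : list (R * state) :=
  arrivals x ++ departures x.

Definition state_eq_dec (x y : state) : {x = y} + {x <> y}.
Proof. repeat decide equality. Defined.

Definition rate (x y : state) : R :=
  sumR (transitions x) (fun e => if state_eq_dec (snd e) y then fst e else 0).
Definition outrate (x : state) : R := sumR (transitions x) fst.

Inductive reach : state -> Prop :=
  | reach_empty : reach []
  | reach_step : forall x y, reach x -> 0 < rate x y -> reach y.

Definition tuple_state (x : state) : Prop :=
  NoDup (toks x) /\ Forall (fun t => (t < nK M)%nat) (toks x).

End WithModel.

(* Main.v *)
Require Import Defs.
From Stdlib Require Import Reals List Permutation Arith Bool Lra Lia FinFun.
Import ListNotations.
Open Scope R_scope.

(** The weights satisfy partial balance: the flow out of [x] by departures equals the flow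
    into [x] by arrivals, and the flow out of [x] by arrivals equals the flow into [x] by
    departures.  The first identity only involves the last customer of [x].  For the second,
    the predecessors of [x] are obtained by inserting a holder of [T] somewhere in the
    customer sequence: if [T] becomes available the sequence is otherwise unchanged; if [T]
    is reclaimed, its holder in [x] was a waiting customer.  In both cases the probability
    that a waiting customer is skipped turns lambda_U(pre + T) back into lambda_U(pre), so
    that only the rates [s] and [k] depend on the place of insertion, and the sum over all
    places collapses by order independence.  The contributions are lambda_T(toks x) for a
    token that becomes available, and increments of lambda_U, which telescope to
    lambda_U(toks x), for the reclaimed ones.  As these identities hold at every state, the
    reachable states are exactly those of positive weight. *)

(** * Finite sums and products over lists *)

Lemma sumR_app {A : Type} (l1 l2 : list A) (f : A -> R) :
  sumR (l1 ++ l2) f = sumR l1 f + sumR l2 f.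
Proof.
  induction l1 as [|a l1 IH]; simpl; [lra|].
  fold (sumR l1 f) (sumR (l1 ++ l2) f). lra.
Qed.

Lemma sumR_cons {A : Type} (a : A) (l : list A) (f : A -> R) :
  sumR (a :: l) f = f a + sumR l f.
Proof. reflexivity. Qed.

Lemma sumR_ext {A : Type} (l : list A) (f g : A -> R) :
  (forall a, In a l -> f a = g a) -> sumR l f = sumR l g.
Proof.
  induction l as [|a l IH]; intros H; [reflexivity|].
  rewrite !sumR_cons, H, IH; [reflexivity|intros; apply H; now right|now left].
Qed.

Lemma sumR_zero {A : Type} (l : list A) (f : A -> R) :
  (forall a, In a l -> f a = 0) -> sumR l f = 0.
Proof.
  induction l as [|a l IH]; intros H; [reflexivity|].
  rewrite sumR_cons, H, IH; [lra|intros; apply H; now right|now left].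
Qed.

Lemma sumR_map {A B : Type} (h : A -> B) (l : list A) (f : B -> R) :
  sumR (map h l) f = sumR l (fun a => f (h a)).
Proof. induction l as [|a l IH]; [reflexivity|]. simpl map. now rewrite !sumR_cons, IH. Qed.

Lemma sumR_flat_map {A B : Type} (h : A -> list B) (l : list A) (f : B -> R) :
  sumR (flat_map h l) f = sumR l (fun a => sumR (h a) f).
Proof.
  induction l as [|a l IH]; [reflexivity|]. simpl flat_map.
  now rewrite sumR_app, sumR_cons, IH.
Qed.

Lemma sumR_scal {A : Type} (c : R) (l : list A) (f : A -> R) :
  sumR l (fun a => c * f a) = c * sumR l f.
Proof. induction l as [|a l IH]; [simpl; lra|]. rewrite !sumR_cons, IH. lra. Qed.

Lemma sumR_plus {A : Type} (l : list A) (f g : A -> R) :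
  sumR l (fun a => f a + g a) = sumR l f + sumR l g.
Proof. induction l as [|a l IH]; [simpl; lra|]. rewrite !sumR_cons, IH. lra. Qed.

Lemma sumR_exchange {A B : Type} (l : list A) (m : list B) (f : A -> B -> R) :
  sumR l (fun a => sumR m (f a)) = sumR m (fun b => sumR l (fun a => f a b)).
Proof.
  induction l as [|a l IH].
  - symmetry. now apply sumR_zero.
  - rewrite sumR_cons, IH, <- sumR_plus. reflexivity.
Qed.

Lemma sumR_nonneg {A : Type} (l : list A) (f : A -> R) :
  (forall a, In a l -> 0 <= f a) -> 0 <= sumR l f.
Proof.
  induction l as [|a l IH]; intros H; [simpl; lra|]. rewrite sumR_cons.
  apply Rplus_le_le_0_compat; [apply H; now left|apply IH; intros; apply H; now right].
Qed.

Lemma sumR_le {A : Type} (l : list A) (f g : A -> R) :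
  (forall a, In a l -> f a <= g a) -> sumR l f <= sumR l g.
Proof.
  induction l as [|a l IH]; intros H; [simpl; lra|]. rewrite !sumR_cons.
  apply Rplus_le_compat; [apply H; now left|apply IH; intros; apply H; now right].
Qed.

Lemma sumR_perm {A : Type} (l1 l2 : list A) (f : A -> R) :
  Permutation l1 l2 -> sumR l1 f = sumR l2 f.
Proof.
  intros H; induction H; [reflexivity| | |lra];
    rewrite !sumR_cons; [now rewrite IHPermutation|lra].
Qed.

Lemma sumR_member_le {A : Type} (l : list A) (f : A -> R) (a : A) :
  (forall b, In b l -> 0 <= f b) -> In a l -> f a <= sumR l f.
Proof.
  intros H Ha. destruct (in_split _ _ Ha) as (l1 & l2 & ->).
  rewrite sumR_app, sumR_cons.
  assert (0 <= sumR l1 f) by (apply sumR_nonneg; intros; apply H; apply in_app_iff; auto).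
  assert (0 <= sumR l2 f) by
    (apply sumR_nonneg; intros; apply H; apply in_app_iff; simpl; auto).
  lra.
Qed.

Lemma sumR_filter_nonzero {A : Type} (l : list A) (f : A -> R) :
  sumR l f = sumR (filter (fun a => if Req_EM_T (f a) 0 then false else true) l) f.
Proof.
  induction l as [|a l IH]; [reflexivity|]. rewrite sumR_cons. simpl.
  destruct (Req_EM_T (f a) 0) as [E|E]; [rewrite E, IH; lra|].
  now rewrite sumR_cons, IH.
Qed.

(** Once zero terms are dropped, both lists are duplicate-free with the same members, hence
    permutations of each other. This later replaces a sum over all candidate predecessors by one
    over an explicit enumeration. *)
Lemma sumR_support_eq {A : Type} (l1 l2 : list A) (f : A -> R) :
  NoDup l1 -> NoDup l2 ->
  (forall a, In a l1 -> f a <> 0 -> In a l2) ->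
  (forall a, In a l2 -> f a <> 0 -> In a l1) ->
  sumR l1 f = sumR l2 f.
Proof.
  intros N1 N2 H1 H2. rewrite (sumR_filter_nonzero l1), (sumR_filter_nonzero l2).
  apply sumR_perm, NoDup_Permutation; try now apply NoDup_filter.
  intros a. rewrite !filter_In.
  destruct (Req_EM_T (f a) 0) as [E|E]; split; intros [Ha ?]; try discriminate; auto.
Qed.

Lemma sumR_single {A : Type} (l : list A) (f : A -> R) (a0 : A) :
  NoDup l -> (forall a, In a l -> f a <> 0 -> a = a0) -> (f a0 <> 0 -> In a0 l) ->
  sumR l f = f a0.
Proof.
  intros N H1 H2. rewrite (sumR_support_eq l [a0] f); auto.
  - simpl. lra.
  - repeat constructor. simpl; tauto.
  - intros a Ha Hf. left. symmetry. auto.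
  - intros a [<-|[]]; auto.
Qed.

Lemma NoDup_flat_map {A B : Type} (h : A -> list B) (l : list A) :
  NoDup l -> (forall a, In a l -> NoDup (h a)) ->
  (forall a a' b, In b (h a) -> In b (h a') -> a = a') ->
  NoDup (flat_map h l).
Proof.
  intros N Hn Hinj. induction N as [|a l Ha N IH]; simpl; [constructor|].
  apply NoDup_app; [apply Hn; now left|apply IH; intros; apply Hn; now right|].
  intros b Hb Hb'. apply in_flat_map in Hb' as (a' & Ha' & Hb').
  now rewrite (Hinj _ _ _ Hb Hb') in Ha.
Qed.

Lemma prodR_app {A : Type} (l1 l2 : list A) (f : A -> R) :
  prodR (l1 ++ l2) f = prodR l1 f * prodR l2 f.
Proof.
  induction l1 as [|a l1 IH]; simpl; [lra|].
  fold (prodR l1 f) (prodR (l1 ++ l2) f). rewrite IH. lra.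
Qed.

Lemma prodR_ext {A : Type} (l : list A) (f g : A -> R) :
  (forall a, In a l -> f a = g a) -> prodR l f = prodR l g.
Proof.
  induction l as [|a l IH]; intros H; [reflexivity|]. simpl.
  fold (prodR l f) (prodR l g). rewrite H, IH; [reflexivity|intros; apply H; now right|now left].
Qed.

Lemma prodR_pos {A : Type} (l : list A) (f : A -> R) :
  (forall a, In a l -> 0 < f a) -> 0 < prodR l f.
Proof.
  induction l as [|a l IH]; intros H; [simpl; lra|].
  apply Rmult_lt_0_compat; [apply H; now left|apply IH; intros; apply H; now right].
Qed.

(** * Decompositions of a list *)

(** A cut is a place where a customer can be inserted; a pivot, below, singles out a customer
    already present. *)
Fixpoint cuts {A : Type} (s : list A) : list (list A * list A) :=
  match s with
  | [] => [([], [])]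
  | o :: s' => ([], s) :: map (fun p => (o :: fst p, snd p)) (cuts s')
  end.

Fixpoint pivots {A : Type} (s : list A) : list (list A * A * list A) :=
  match s with
  | [] => []
  | o :: s' => ([], o, s') :: map (fun p => (o :: fst (fst p), snd (fst p), snd p)) (pivots s')
  end.

Lemma in_cuts {A : Type} (s a b : list A) : In (a, b) (cuts s) <-> s = a ++ b.
Proof.
  revert a b; induction s as [|o s IH]; intros a b; simpl.
  - split.
    + intros [[= <- <-]|[]]; reflexivity.
    + intros E. symmetry in E. apply app_eq_nil in E as [-> ->]. now left.
  - split.
    + intros [[= <- <-]|H]; [reflexivity|].
      apply in_map_iff in H as ([a' b'] & [= <- <-] & H). simpl. f_equal. now apply IH.
    + destruct a as [|o' a]; simpl; intros E; [left; now rewrite E|].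
      right. injection E as -> E. apply in_map_iff. exists (a, b). split; [reflexivity|now apply IH].
Qed.

Lemma in_pivots {A : Type} (s a c : list A) (o : A) :
  In (a, o, c) (pivots s) <-> s = a ++ o :: c.
Proof.
  revert a c; induction s as [|u s IH]; intros a c; simpl.
  - split; [intros []|]. now destruct a.
  - split.
    + intros [[= <- <- <-]|H]; [reflexivity|].
      apply in_map_iff in H as ([[a' u'] c'] & [= <- <- <-] & H). simpl. f_equal. now apply IH.
    + destruct a as [|o' a]; simpl; intros E; [left; now injection E as -> ->|].
      right. injection E as -> E. apply in_map_iff. exists (a, o, c).
      split; [reflexivity|now apply IH].
Qed.

Lemma NoDup_cuts {A : Type} (s : list A) : NoDup (cuts s).
Proof.
  induction s as [|o s IH]; simpl; [repeat constructor; simpl; tauto|].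
  constructor.
  - intros H. apply in_map_iff in H as (p & [=] & _).
  - apply Injective_map_NoDup; [|exact IH]. intros [a b] [a' b'] [= -> ->]. reflexivity.
Qed.

Lemma NoDup_pivots {A : Type} (s : list A) : NoDup (pivots s).
Proof.
  induction s as [|o s IH]; simpl; [constructor|].
  constructor.
  - intros H. apply in_map_iff in H as (p & [=] & _).
  - apply Injective_map_NoDup; [|exact IH]. intros [[a u] b] [[a' u'] b'] [= -> -> ->]. reflexivity.
Qed.

(** Prepares inductions on the last customer: the only cut not inherited from [s] is the one after
    [o]. *)
Lemma cuts_snoc {A : Type} (s : list A) (o : A) :
  cuts (s ++ [o]) = map (fun p => (fst p, snd p ++ [o])) (cuts s) ++ [(s ++ [o], [])].
Proof.
  induction s as [|u s IH]; [reflexivity|]. simpl. rewrite IH, map_app, !map_map. reflexivity.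
Qed.

(** Links the indices used in [departures] with the structural recursion used here; [d] is never
    returned, as all indices are in range. *)
Lemma pivots_index {A : Type} (d : A) (s : list A) :
  pivots s = map (fun r => (firstn r s, nth r s d, skipn (S r) s)) (seq 0 (length s)).
Proof.
  induction s as [|u s IH]; [reflexivity|]. simpl. rewrite IH, map_map.
  rewrite <- seq_shift, map_map. reflexivity.
Qed.

(** * Customer sequences *)

(** [pre] accumulates the holders that precede the current position. *)
Fixpoint pprod (g : list nat -> option nat -> R) (pre : list nat) (s : list (option nat)) : R :=
  match s with
  | [] => 1
  | o :: s' => g pre o * pprod g (pre ++ holders [o]) s'
  end.

Lemma holders_app (a b : list (option nat)) : holders (a ++ b) = holders a ++ holders b.
Proof. apply flat_map_app. Qed.

Lemma pprod_app g pre a b :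
  pprod g pre (a ++ b) = pprod g pre a * pprod g (pre ++ holders a) b.
Proof.
  revert pre; induction a as [|o a IH]; intros pre; simpl.
  - rewrite app_nil_r. lra.
  - rewrite IH. simpl. rewrite !app_nil_r, <- app_assoc. lra.
Qed.

Lemma pprod_nonneg g pre s : (forall q o, 0 <= g q o) -> 0 <= pprod g pre s.
Proof.
  intros H; revert pre; induction s as [|o s IH]; intros pre; simpl; [lra|].
  now apply Rmult_le_pos.
Qed.

(** The two starting prefixes may differ, because the factors often depend on the preceding holders
    only as a set or up to order. *)
Lemma pprod_ext g g' pre pre' s :
  (forall a o c, s = a ++ o :: c -> g (pre ++ holders a) o = g' (pre' ++ holders a) o) ->
  pprod g pre s = pprod g' pre' s.
Proof.
  revert pre pre'; induction s as [|o s IH]; intros pre pre' H; cbn [pprod]; [reflexivity|].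
  f_equal.
  - specialize (H [] o s eq_refl). simpl in H. now rewrite !app_nil_r in H.
  - apply IH. intros a u c E. rewrite <- !app_assoc, <- !holders_app.
    apply (H ([o] ++ a) u c). simpl. now rewrite E.
Qed.

Lemma to_seq_app x y : to_seq (x ++ y) = to_seq x ++ to_seq y.
Proof. apply flat_map_app. Qed.

Lemma holders_repeat_None n : holders (repeat None n) = [].
Proof. induction n; simpl; auto. Qed.

Lemma holders_to_seq x : holders (to_seq x) = toks x.
Proof.
  induction x as [|[t n] x IH]; [reflexivity|]. simpl to_seq.
  change (holders (([Some t] ++ repeat None n) ++ to_seq x) = t :: toks x).
  rewrite !holders_app, holders_repeat_None, IH. reflexivity.
Qed.

Lemma length_to_seq x : length (to_seq x) = phi x.
Proof.
  induction x as [|[t n] x IH]; [reflexivity|]. unfold phi in *. simpl.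
  rewrite length_app, repeat_length, IH. lia.
Qed.

Lemma incr_last_snoc x t n : incr_last (x ++ [(t, n)]) = x ++ [(t, S n)].
Proof.
  induction x as [|e x IH]; [reflexivity|]. simpl. rewrite IH.
  destruct x; reflexivity.
Qed.

Lemma repeat_snoc {A : Type} (a : A) n : repeat a n ++ [a] = repeat a (S n).
Proof. induction n; simpl; [reflexivity|]. now rewrite IHn. Qed.

Lemma to_seq_incr_last x : x <> [] -> to_seq (incr_last x) = to_seq x ++ [None].
Proof.
  intros H. destruct (exists_last H) as (x' & [t n] & ->).
  rewrite incr_last_snoc, !to_seq_app. simpl to_seq. rewrite !app_nil_r, <- app_assoc.
  change (repeat None (S n)) with (@None nat :: repeat None n).
  change ([Some t] ++ repeat None n) with (Some t :: repeat (@None nat) n).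
  f_equal. simpl. f_equal. symmetry. apply repeat_snoc.
Qed.

(** Characterises the sequences that come from states. On other sequences [of_seq] loses the leading
    waiting customers, since [incr_last []] is [[]]. *)
Definition headed (s : list (option nat)) : Prop :=
  match s with None :: _ => False | _ => True end.

Lemma headed_to_seq x : headed (to_seq x).
Proof. now destruct x. Qed.

Lemma headed_app a b : headed (a ++ b) -> headed a.
Proof. now destruct a as [|[]]. Qed.

Lemma of_seq_snoc s o : of_seq (s ++ [o]) =
  match o with Some t => of_seq s ++ [(t, 0%nat)] | None => incr_last (of_seq s) end.
Proof. unfold of_seq. rewrite fold_left_app. reflexivity. Qed.

Lemma to_seq_of_seq s : headed s -> to_seq (of_seq s) = s.
Proof.
  induction s as [|o s IH] using rev_ind; intros H; [reflexivity|].
  assert (Hs := headed_app _ _ H). rewrite of_seq_snoc.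
  destruct o as [t|].
  - rewrite to_seq_app, IH; auto.
  - rewrite to_seq_incr_last, IH; auto. intros E.
    apply IH in Hs. rewrite E in Hs. simpl in Hs. subst s. exact H.
Qed.

Lemma of_seq_to_seq x : of_seq (to_seq x) = x.
Proof.
  induction x as [|[t n] x IH] using rev_ind; [reflexivity|].
  rewrite to_seq_app. simpl to_seq. rewrite app_nil_r.
  induction n as [|n IHn].
  - simpl. now rewrite of_seq_snoc, IH.
  - rewrite <- repeat_snoc.
    change (Some t :: repeat None n ++ [None]) with ((Some t :: repeat (@None nat) n) ++ [None]).
    rewrite app_assoc, of_seq_snoc, IHn. apply incr_last_snoc.
Qed.

Lemma to_seq_inj x y : to_seq x = to_seq y -> x = y.
Proof. intros H. now rewrite <- (of_seq_to_seq x), H, of_seq_to_seq. Qed.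

(** * The weight of a customer sequence *)

Section Weight.
Variable M : model.

Definition lam_factor (pre : list nat) (o : option nat) : R :=
  match o with Some t => lamtok M pre t | None => 1 end.
Definition lamU_factor (pre : list nat) (o : option nat) : R :=
  match o with Some _ => 1 | None => lamU M pre end.
(** Every customer contributes one factor 1/k: for a holder it is the new factor of 1/[Pi_k], for a
    waiting customer the denominator of its alpha. *)
Definition k_factor (pre : list nat) (o : option nat) : R := / kfun M (pre ++ holders [o]).
Definition eta_factor (n : nat) : R := prodR (seq 1 n) (fun m => / eta M m).

(** [Pi_lam] is kept whole instead of being spread over the customers, so that the assignment
    condition applies to it directly. *)
Definition seq_weight (s : list (option nat)) : R :=
  Pi_lam M (holders s) * pprod lamU_factor [] s * pprod k_factor [] s * eta_factor (length s).

Lemma firstn_snoc_le {A : Type} j (l : list A) t :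
  (j <= length l)%nat -> firstn j (l ++ [t]) = firstn j l.
Proof.
  intros H. rewrite firstn_app. replace (j - length l)%nat with 0%nat by lia.
  simpl. apply app_nil_r.
Qed.

Lemma Pi_lam_snoc l t : Pi_lam M (l ++ [t]) = Pi_lam M l * lamtok M l t.
Proof.
  unfold Pi_lam. rewrite length_app. simpl. rewrite Nat.add_1_r, seq_S, prodR_app. f_equal.
  - apply prodR_ext. intros j Hj. apply in_seq in Hj.
    rewrite firstn_snoc_le, app_nth1 by lia. reflexivity.
  - simpl. rewrite firstn_snoc_le, firstn_all, nth_middle by lia. lra.
Qed.

Lemma kfun_snoc l t : kfun M (l ++ [t]) = kfun M l + srate M (l ++ [t]).
Proof.
  unfold kfun. rewrite length_app. simpl. rewrite Nat.add_1_r, seq_S, sumR_app. f_equal.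
  - apply sumR_ext. intros j Hj. apply in_seq in Hj.
    rewrite firstn_snoc_le by lia. reflexivity.
  - cbn [sumR fold_right]. rewrite (firstn_all2 (n := 1 + length l)) by
      (rewrite length_app; simpl; lia). lra.
Qed.

Lemma Pi_k_snoc l t : Pi_k M (l ++ [t]) = Pi_k M l * kfun M (l ++ [t]).
Proof.
  unfold Pi_k. rewrite length_app. simpl. rewrite Nat.add_1_r, seq_S, prodR_app. f_equal.
  - apply prodR_ext. intros j Hj. apply in_seq in Hj.
    rewrite firstn_snoc_le by lia. reflexivity.
  - cbn [prodR fold_right]. rewrite (firstn_all2 (n := 1 + length l)) by
      (rewrite length_app; simpl; lia). lra.
Qed.

Lemma pprod_repeat_None g pre n : pprod g pre (repeat None n) = g pre None ^ n.
Proof. induction n as [|n IH]; simpl; [lra|]. now rewrite app_nil_r, IH. Qed.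

(** The block of a holder followed by n waiting customers contributes 1/k times (lambda_U/k)^n; the
    proof adds one block at the end at a time. *)
Lemma queue_factor_to_seq x :
  / Pi_k M (toks x)
    * prodR (seq 1 (length x))
        (fun j => alpha M (toks x) j ^ snd (nth (j - 1) x (0%nat, 0%nat)))
  = pprod lamU_factor [] (to_seq x) * pprod k_factor [] (to_seq x).
Proof.
  induction x as [|[t n] x IH] using rev_ind.
  - unfold Pi_k. simpl. lra.
  - unfold toks in *. rewrite to_seq_app, !pprod_app, holders_to_seq, map_app.
    simpl map. rewrite Pi_k_snoc, length_app. simpl length.
    rewrite Nat.add_1_r, seq_S, prodR_app.
    assert (L : length (map fst x) = length x) by apply length_map.
    rewrite (prodR_ext (seq 1 (length x)) _
       (fun j => alpha M (map fst x) j ^ snd (nth (j - 1) x (0%nat, 0%nat)))).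
    2:{ intros j Hj. apply in_seq in Hj. unfold alpha.
        rewrite firstn_snoc_le, app_nth1 by lia. reflexivity. }
    rewrite Rinv_mult.
    match goal with |- ?a * ?b * (?c * ?d) = ?e * ?f * (?g * ?h) =>
      replace (a * b * (c * d)) with ((a * c) * (b * d)) by ring;
      replace (e * f * (g * h)) with ((e * g) * (f * h)) by ring end.
    rewrite IH. f_equal. simpl to_seq. rewrite app_nil_r. cbn [pprod].
    rewrite !pprod_repeat_None. unfold lamU_factor, k_factor. simpl holders.
    rewrite app_nil_r. simpl prodR. rewrite Nat.sub_0_r, nth_middle. simpl snd.
    unfold alpha.
    rewrite (firstn_all2 (n := S (length x)) (map fst x ++ [t]))
      by (rewrite length_app, length_map; simpl; lia).
    unfold toks. unfold Rdiv. rewrite Rpow_mult_distr. cbn [app]. ring.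
Qed.

Lemma weight_seq_weight x : weight M x = seq_weight (to_seq x).
Proof.
  unfold weight, seq_weight, Rdiv. cbv zeta.
  rewrite holders_to_seq, length_to_seq.
  rewrite (Rmult_assoc (Pi_lam M (toks x))), queue_factor_to_seq. unfold eta_factor. ring.
Qed.

Lemma seq_weight_snoc s o :
  seq_weight (s ++ [o]) =
  seq_weight s * lam_factor (holders s) o * lamU_factor (holders s) o
    * / kfun M (holders (s ++ [o])) * / eta M (S (length s)).
Proof.
  unfold seq_weight. rewrite !pprod_app, length_app, holders_app. simpl length.
  rewrite Nat.add_1_r. unfold eta_factor at 1. rewrite seq_S, prodR_app.
  fold (eta_factor (length s)). simpl prodR. simpl app at 2. cbn [pprod].
  unfold k_factor at 2.
  replace (Pi_lam M (holders s ++ holders [o]))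
    with (Pi_lam M (holders s) * lam_factor (holders s) o).
  - simpl app. ring.
  - destruct o; simpl; [now rewrite Pi_lam_snoc|rewrite app_nil_r; lra].
Qed.

End Weight.

Lemma pivots_app {A : Type} (s s' : list A) :
  pivots (s ++ s') =
    map (fun p => (fst (fst p), snd (fst p), snd p ++ s')) (pivots s)
    ++ map (fun p => (s ++ fst (fst p), snd (fst p), snd p)) (pivots s').
Proof.
  induction s as [|o s IH]; simpl.
  - rewrite <- (map_id (pivots s')) at 1. apply map_ext. now intros [[a u] c].
  - f_equal. rewrite IH, map_app, !map_map. reflexivity.
Qed.

(** Pivots at waiting customers count zero, so the remaining pivots are the holders, one for each
    entry of [x]. *)
Lemma sumR_pivots_to_seq (G : list (option nat) -> nat -> list (option nat) -> R) x :
  sumR (pivots (to_seq x))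
    (fun p => match p with (a, Some T, c) => G a T c | _ => 0 end)
  = sumR (seq 0 (length x))
      (fun j => G (to_seq (firstn j x)) (nth j (toks x) 0%nat)
                  (repeat None (snd (nth j x (0%nat, 0%nat))) ++ to_seq (skipn (S j) x))).
Proof.
  revert G; induction x as [|[t n] x IH]; intros G; [reflexivity|].
  cbn [length]. cbn [seq]. rewrite sumR_cons, <- seq_shift, sumR_map.
  change (to_seq ((t, n) :: x)) with (([Some t] ++ repeat None n) ++ to_seq x).
  rewrite pivots_app, sumR_app, !sumR_map. f_equal.
  - simpl pivots. rewrite sumR_cons, sumR_map, sumR_zero; [simpl; lra|].
    intros [[a o] c] H. apply in_pivots in H. simpl.
    rewrite (repeat_spec n (None : option nat) o); [reflexivity|].
    rewrite H. apply in_elt.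
  - specialize (IH (fun a T c => G (([Some t] ++ repeat None n) ++ a) T c)).
    simpl in IH |- *. rewrite <- IH. apply sumR_ext. now intros [[a [T|]] c] _.
Qed.

Lemma memb_In t l : memb t l = true <-> In t l.
Proof.
  unfold memb. rewrite existsb_exists. split.
  - intros (u & H & E). apply Nat.eqb_eq in E. now subst.
  - intros H. exists t. split; [exact H|apply Nat.eqb_refl].
Qed.

(** * Transition flows and partial balance *)

Section Dynamics.
Variable M : model.
Hypothesis Hlam : forall c, (c < nC M)%nat -> 0 < lam M c.
Hypothesis Hcompat :
  forall c, (c < nC M)%nat -> exists t, (t < nK M)%nat /\ compat M c t = true.
Hypothesis Hp_nonneg : forall c Rs t, 0 <= assign M c Rs t.
Hypothesis Hp_supp : forall c Rs t, assign M c Rs t <> 0 ->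
  (t < nK M)%nat /\ compat M c t = true /\ ~ In t Rs.
Hypothesis Hs_nonneg : forall l, 0 <= srate M l.
Hypothesis Heta : forall m, (1 <= m)%nat -> 0 < eta M m.

Lemma inU_spec l c : inU M l c = true <->
  (forall t, (t < nK M)%nat -> compat M c t = true -> In t l).
Proof.
  unfold inU. rewrite forallb_forall. split.
  - intros H t Ht Hc. specialize (H t). rewrite Hc in H. simpl in H.
    apply memb_In, H, in_seq. lia.
  - intros H t Ht. apply in_seq in Ht. destruct (compat M c t) eqn:E; [|reflexivity].
    simpl. apply memb_In, H; [lia|exact E].
Qed.

Lemma lamU_ext l l' : (forall u, In u l <-> In u l') -> lamU M l = lamU M l'.
Proof.
  intros H. apply sumR_ext. intros c _.
  replace (inU M l' c) with (inU M l c); [reflexivity|].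
  apply eq_true_iff_eq. rewrite !inU_spec. split; intros G t Ht Hc; apply H; now apply G.
Qed.

Lemma lamU_incl l l' : incl l l' -> lamU M l <= lamU M l'.
Proof.
  intros H. apply sumR_le. intros c Hc. apply in_seq in Hc.
  assert (0 < lam M c) by (apply Hlam; lia).
  destruct (inU M l c) eqn:E.
  - assert (E' : inU M l' c = true).
    { apply inU_spec. intros t Ht Hct. apply H. apply inU_spec with (1 := E); assumption. }
    rewrite E'. lra.
  - destruct (inU M l' c); lra.
Qed.

(** Every type has a compatible token, so no type is blocked when all tokens are free. Consequently
    a sequence that starts with a waiting customer has weight zero. *)
Lemma lamU_nil : lamU M [] = 0.
Proof.
  apply sumR_zero. intros c Hc. apply in_seq in Hc.
  destruct (inU M [] c) eqn:E; [|reflexivity].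
  destruct (Hcompat c) as (t & Ht & Hct); [lia|].
  now destruct (proj1 (inU_spec [] c) E t Ht Hct).
Qed.

Lemma lamU_nonneg l : 0 <= lamU M l.
Proof. rewrite <- lamU_nil. now apply lamU_incl. Qed.

Lemma lamtok_nonneg l t : 0 <= lamtok M l t.
Proof.
  apply sumR_nonneg. intros c Hc. apply in_seq in Hc.
  apply Rmult_le_pos; [left; apply Hlam; lia|apply Hp_nonneg].
Qed.

Lemma lamtok_nonzero l t : lamtok M l t <> 0 -> (t < nK M)%nat /\ ~ In t l.
Proof.
  intros H. destruct (lt_dec t (nK M)) as [Ht|Ht]; [destruct (in_dec Nat.eq_dec t l) as [Hi|Hi]|].
  2: now split.
  all: destruct H; apply sumR_zero; intros c _;
    (destruct (Req_EM_T (assign M c l t) 0) as [E|E]; [rewrite E; lra|]);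
    apply Hp_supp in E; tauto.
Qed.

Lemma kfun_nonneg l : 0 <= kfun M l.
Proof. apply sumR_nonneg. intros; apply Hs_nonneg. Qed.

Lemma Rinv_nonneg r : 0 <= r -> 0 <= / r.
Proof.
  intros [H|<-]; [left; now apply Rinv_0_lt_compat|rewrite Rinv_0; lra].
Qed.

Lemma eta_factor_pos n : 0 < eta_factor M n.
Proof.
  apply prodR_pos. intros m Hm. apply in_seq in Hm. apply Rinv_0_lt_compat, Heta. lia.
Qed.

Lemma Pi_lam_nonneg l : 0 <= Pi_lam M l.
Proof.
  induction l as [|t l IH] using rev_ind; [unfold Pi_lam; simpl; lra|].
  rewrite Pi_lam_snoc. apply Rmult_le_pos; [exact IH|apply lamtok_nonneg].
Qed.

Lemma seq_weight_nonneg s : 0 <= seq_weight M s.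
Proof.
  unfold seq_weight. apply Rmult_le_pos; [|left; apply eta_factor_pos].
  repeat apply Rmult_le_pos; [apply Pi_lam_nonneg| |];
    apply pprod_nonneg; intros q o.
  - destruct o; simpl; [lra|apply lamU_nonneg].
  - apply Rinv_nonneg, kfun_nonneg.
Qed.

(** A repeated or out-of-range token makes one of the claiming rates vanish. Hence a nonzero weight
    already supplies the validity needed to use the hypotheses on k and on the assignment rule. *)
Lemma Pi_lam_nonzero l : Pi_lam M l <> 0 ->
  NoDup l /\ Forall (fun t => (t < nK M)%nat) l.
Proof.
  induction l as [|t l IH] using rev_ind; [split; constructor|].
  rewrite Pi_lam_snoc. intros H.
  destruct IH as [N F]; [intros E; apply H; rewrite E; lra|].
  destruct (lamtok_nonzero l t) as [Ht Hi]; [intros E; apply H; rewrite E; lra|].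
  split.
  - apply NoDup_app; [exact N|repeat constructor; simpl; tauto|].
    intros a Ha [<-|[]]. tauto.
  - apply Forall_app. split; [exact F|repeat constructor; exact Ht].
Qed.

Lemma seq_weight_nonzero s : seq_weight M s <> 0 ->
  headed s /\ NoDup (holders s) /\ Forall (fun t => (t < nK M)%nat) (holders s).
Proof.
  unfold seq_weight. intros H. split.
  - destruct s as [|[t|] s]; simpl; auto. apply H. simpl. rewrite lamU_nil. lra.
  - apply Pi_lam_nonzero. intros E. apply H. rewrite E. lra.
Qed.

(** * Probability of skipping a freed token *)

Definition qskip (T : nat) (l : list nat) : R :=
  if Req_EM_T (lamU M (T :: l)) 0 then 1 else lamU M l / lamU M (T :: l).
Definition pass_factor (T : nat) (pre : list nat) (o : option nat) : R :=
  match o with Some _ => 1 | None => qskip T pre end.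

Lemma qskip_bounds T l : 0 <= qskip T l <= 1.
Proof.
  unfold qskip. destruct (Req_EM_T (lamU M (T :: l)) 0) as [E|E]; [lra|].
  assert (H := lamU_nonneg (T :: l)). assert (H0 := lamU_nonneg l).
  assert (H1 : lamU M l <= lamU M (T :: l)) by (apply lamU_incl; intros a; now right).
  split; [apply Rmult_le_pos; [lra|left; apply Rinv_0_lt_compat; lra]|].
  apply Rmult_le_reg_r with (lamU M (T :: l)); [lra|].
  unfold Rdiv. rewrite Rmult_assoc, Rinv_l; lra.
Qed.

(** The default value 1 for a zero denominator is consistent: by monotonicity [lamU M l] is then
    zero as well. *)
Lemma qskip_mult T l : lamU M (T :: l) * qskip T l = lamU M l.
Proof.
  unfold qskip. destruct (Req_EM_T (lamU M (T :: l)) 0) as [E|E]; [|field; exact E].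
  assert (H0 := lamU_nonneg l).
  assert (H1 : lamU M l <= lamU M (T :: l)) by (apply lamU_incl; intros a; now right).
  lra.
Qed.

Lemma prodR_passf T s1 s2 r : (r <= length s2)%nat ->
  prodR (seq 0 r) (passf M T s1 s2) = pprod (pass_factor T) (holders s1) (firstn r s2).
Proof.
  induction r as [|r IH]; intros H; [reflexivity|].
  rewrite seq_S, prodR_app, IH by lia.
  destruct (nth_error s2 r) as [o|] eqn:E; [|apply nth_error_None in E; lia].
  assert (Hn : firstn (S r) s2 = firstn r s2 ++ [o]).
  { rewrite <- (firstn_skipn r s2), firstn_app, firstn_firstn.
    rewrite length_firstn. replace (Nat.min (S r) r) with r by lia.
    replace (S r - Nat.min r (length s2))%nat with 1%nat by lia.
    rewrite firstn_skipn. f_equal.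
    rewrite <- (firstn_skipn_middle _ _ E) at 1.
    rewrite skipn_app, length_firstn.
    replace (r - Nat.min r (length s2))%nat with 0%nat by lia.
    rewrite skipn_all2 by (rewrite length_firstn; lia). reflexivity. }
  rewrite Hn, pprod_app. f_equal. cbn [pprod prodR fold_right]. f_equal.
  unfold passf. simpl. rewrite (nth_error_nth _ _ _ E).
  destruct o; [reflexivity|]. unfold qpass, pass_factor. now rewrite holders_app.
Qed.

(** Integrates a test function against the transition rates. The constant 1 gives a total outflow
    and an indicator gives the rate into one state, so a single formula serves both. *)
Definition flow (l : list (R * state)) (F : state -> R) : R :=
  sumR l (fun e => fst e * F (snd e)).

Definition indicator (x y : state) : R := if state_eq_dec y x then 1 else 0.

Lemma rate_flow x y : rate M x y = flow (arrivals M x) (indicator y) + flow (departures M x) (indicator y).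
Proof.
  unfold rate, flow, transitions. rewrite <- sumR_app. apply sumR_ext.
  intros e _. unfold indicator. destruct (state_eq_dec (snd e) y); lra.
Qed.

Lemma outrate_flow x :
  outrate M x = flow (arrivals M x) (fun _ => 1) + flow (departures M x) (fun _ => 1).
Proof.
  unfold outrate, flow, transitions. rewrite <- sumR_app. apply sumR_ext. intros; lra.
Qed.

(** A type finds no available compatible token exactly when it lies in U([toks y]), which separates
    the two branches of [arrivals]. For such a type all assignment probabilities vanish by the
    support hypothesis, so the sum over tokens may range over all types. *)
Lemma arrival_flow y F :
  flow (arrivals M y) F =
  sumR (seq 0 (nK M)) (fun t => lamtok M (toks y) t * F (y ++ [(t, 0%nat)]))
  + lamU M (toks y) * F (incr_last y).
Proof.
  unfold flow, arrivals. rewrite sumR_flat_map.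
  transitivity (sumR (seq 0 (nC M)) (fun c =>
    sumR (seq 0 (nK M)) (fun t => lam M c * assign M c (toks y) t * F (y ++ [(t, 0%nat)]))
    + F (incr_last y) * (if inU M (toks y) c then lam M c else 0))).
  - apply sumR_ext. intros c _.
    destruct (existsb _ _) eqn:E.
    + replace (inU M (toks y) c) with false.
      * rewrite sumR_map. simpl. lra.
      * symmetry. apply not_true_iff_false. rewrite inU_spec. intros H.
        apply existsb_exists in E as (t & Ht & E). apply in_seq in Ht.
        apply andb_prop in E as [Hc Hm]. apply negb_true_iff in Hm.
        assert (memb t (toks y) = true) by (apply memb_In, H; [lia|exact Hc]). congruence.
    + assert (U : inU M (toks y) c = true).
      { apply inU_spec. intros t Ht Hc. apply memb_In.
        destruct (memb t (toks y)) eqn:Hm; [reflexivity|].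
        rewrite <- E. apply existsb_exists. exists t.
        split; [apply in_seq; lia|]. now rewrite Hc, Hm. }
      rewrite U. rewrite sumR_cons. simpl. rewrite sumR_zero; [lra|].
      intros t _. destruct (Req_EM_T (assign M c (toks y) t) 0) as [Z|Z]; [rewrite Z; lra|].
      apply Hp_supp in Z as (Ht & Hc & Hi). destruct Hi.
      now apply (proj1 (inU_spec _ _) U).
  - rewrite sumR_plus, sumR_scal. unfold lamU. f_equal; [|lra].
    rewrite sumR_exchange. apply sumR_ext. intros t _. unfold lamtok.
    rewrite Rmult_comm, <- sumR_scal. apply sumR_ext. intros; lra.
Qed.

(** Holder of [T] standing between [a] and [c]: everyone in [c] skips the freed token. In
    [reclaim_term] the customers in [b] skip it and the waiting customer at the pivot takes it,
    keeping its own position. *)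
Definition leave_term (F : state -> R) (a : list (option nat)) (T : nat) (c : list (option nat)) : R :=
  pprod (pass_factor T) (holders a) c * F (of_seq (a ++ c)).
Definition reclaim_term (F : state -> R) (a : list (option nat)) (T : nat)
    (p : list (option nat) * option nat * list (option nat)) : R :=
  match p with
  | (b, None, d) => pprod (pass_factor T) (holders a) b * (1 - qskip T (holders (a ++ b)))
                    * F (of_seq (a ++ b ++ Some T :: d))
  | _ => 0
  end.

Lemma departure_flow y F :
  flow (departures M y) F =
  sumR (pivots (to_seq y)) (fun p => match p with
    | (a, Some T, c) => eta M (phi y) * srate M (holders a ++ [T]) *
        (leave_term F a T c + sumR (pivots c) (reclaim_term F a T))
    | _ => 0 end).
Proof.
  rewrite (sumR_pivots_to_seq (fun a T c => eta M (phi y) * srate M (holders a ++ [T]) *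
        (leave_term F a T c + sumR (pivots c) (reclaim_term F a T)))).
  unfold flow, departures. rewrite sumR_flat_map. apply sumR_ext.
  intros j Hj. apply in_seq in Hj. cbv zeta.
  set (T := nth j (toks y) 0%nat). set (s1 := to_seq (firstn j y)).
  set (s2 := repeat None _ ++ _).
  replace (firstn (S j) (toks y)) with (holders s1 ++ [T]).
  2:{ unfold s1, T. rewrite holders_to_seq. unfold toks.
      assert (Hl : (j < length (map fst y))%nat) by (rewrite length_map; lia).
      destruct (nth_error (map fst y) j) as [t|] eqn:E; [|apply nth_error_None in E; lia].
      rewrite (nth_error_nth _ _ _ E), <- firstn_map.
      rewrite <- (firstn_skipn_middle _ _ E) at 2.
      replace (S j) with (length (firstn j (map fst y)) + 1)%nat by (rewrite length_firstn; lia).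
      rewrite firstn_app_2. reflexivity. }
  set (base := eta M (phi y) * srate M (holders s1 ++ [T])).
  rewrite sumR_cons, Rmult_plus_distr_l. f_equal.
  - simpl. rewrite prodR_passf, firstn_all by lia. unfold leave_term. ring.
  - rewrite (pivots_index (Some 0%nat)), sumR_map, sumR_flat_map, <- sumR_scal.
    apply sumR_ext. intros r Hr. apply in_seq in Hr. unfold reclaim_term.
    destruct (nth r s2 (Some 0%nat)); [simpl; lra|].
    rewrite sumR_cons. cbn [fst snd]. rewrite prodR_passf by lia.
    change (qpass M T (s1 ++ firstn r s2)) with (qskip T (holders (s1 ++ firstn r s2))).
    simpl sumR. ring.
Qed.


(** * Total departure rate *)

Lemma sumR_pivots_telescope (G : list nat -> R) s :
  sumR (pivots s) (fun p => match p with
    | (a, Some T, _) => G (holders a ++ [T]) - G (holders a) | _ => 0 end)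
  = G (holders s) - G [].
Proof.
  induction s as [|o s IH] using rev_ind; [simpl; lra|].
  rewrite pivots_app, sumR_app, !sumR_map. simpl pivots. rewrite sumR_cons.
  rewrite (sumR_ext (pivots s) _ (fun p => match p with
    | (a, Some T, _) => G (holders a ++ [T]) - G (holders a) | _ => 0 end)).
  2:{ now intros [[a u] c] _. }
  rewrite IH. simpl. rewrite app_nil_r, holders_app.
  destruct o; simpl; [|rewrite app_nil_r]; lra.
Qed.

(** Total probability: the freed token is taken by the first compatible waiting customer or by
    nobody. The induction conditions on whether the first customer of [c] skips it. *)
Lemma leave_or_reclaim T a c :
  leave_term (fun _ => 1) a T c + sumR (pivots c) (reclaim_term (fun _ => 1) a T) = 1.
Proof.
  unfold leave_term. revert a; induction c as [|o c IH]; intros a; [simpl; lra|].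
  cbn [pivots]. rewrite sumR_cons, sumR_map.
  rewrite (sumR_ext (pivots c) _
    (fun p => pass_factor T (holders a) o * reclaim_term (fun _ => 1) (a ++ [o]) T p)).
  2:{ intros [[b [u|]] d] _; cbn [reclaim_term fst snd]; [lra|].
      cbn [pprod]. rewrite <- holders_app, <- app_assoc. simpl app. lra. }
  rewrite sumR_scal. specialize (IH (a ++ [o])).
  cbn [pprod]. rewrite <- holders_app.
  replace (sumR (pivots c) (reclaim_term (fun _ => 1) (a ++ [o]) T))
    with (1 - pprod (pass_factor T) (holders (a ++ [o])) c) by lra.
  destruct o; cbn [reclaim_term pprod pass_factor fst snd]; [lra|rewrite app_nil_r; lra].
Qed.

(** By [kfun_snoc] each s_j is an increment of k, so the departure rates of the holders telescope to
    k of all tokens. *)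
Lemma departure_outflow y :
  flow (departures M y) (fun _ => 1) = eta M (phi y) * kfun M (toks y).
Proof.
  rewrite departure_flow.
  rewrite (sumR_ext _ _ (fun p => eta M (phi y) * match p with
    | (a, Some T, _) => kfun M (holders a ++ [T]) - kfun M (holders a) | _ => 0 end)).
  - rewrite sumR_scal, sumR_pivots_telescope, holders_to_seq.
    change (kfun M []) with 0. ring.
  - intros [[a [T|]] c] _; [|lra]. rewrite leave_or_reclaim, kfun_snoc. ring.
Qed.

(** Customer by customer, [qskip_mult] cancels the presence of [T]; the holder lists matter only as
    sets. *)
Lemma lamU_factor_pass T pre pre' c :
  (forall u, In u pre' <-> In u (T :: pre)) ->
  pprod (lamU_factor M) pre' c * pprod (pass_factor T) pre c = pprod (lamU_factor M) pre c.
Proof.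
  revert pre pre'; induction c as [|o c IH]; intros pre pre' H; cbn [pprod]; [lra|].
  rewrite <- (IH (pre ++ holders [o]) (pre' ++ holders [o])).
  - replace (lamU_factor M pre o) with (lamU_factor M pre' o * pass_factor T pre o); [ring|].
    destruct o; simpl; [lra|]. now rewrite (lamU_ext _ _ H), qskip_mult.
  - intros u. specialize (H u). cbn [In]. rewrite !in_app_iff, H. cbn [In]. tauto.
Qed.

Lemma headed_of_lamU_factor s : pprod (lamU_factor M) [] s <> 0 -> headed s.
Proof.
  destruct s as [|[t|] s]; simpl; auto. rewrite lamU_nil. lra.
Qed.

Lemma eta_factor_S n : eta_factor M (S n) * eta M (S n) = eta_factor M n.
Proof.
  unfold eta_factor. rewrite seq_S, prodR_app. simpl.
  assert (0 < eta M (S n)) by (apply Heta; lia). field. lra.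
Qed.

(** * Order independence and sums over insertion places *)

Hypothesis Hassign : forall l1 l2, NoDup l1 -> Forall (fun t => (t < nK M)%nat) l1 ->
  Permutation l1 l2 -> Pi_lam M l1 = Pi_lam M l2.
Hypothesis Hk_perm : forall l1 l2, NoDup l1 -> Forall (fun t => (t < nK M)%nat) l1 ->
  Permutation l1 l2 -> kfun M l1 = kfun M l2.
Hypothesis Hk_pos : forall l, l <> [] -> NoDup l -> Forall (fun t => (t < nK M)%nat) l ->
  0 < kfun M l.

(** Removes the validity assumptions from the assignment condition: if either product is nonzero its
    tuple is valid, and otherwise both are zero. *)
Lemma Pi_lam_perm l l' : Permutation l l' -> Pi_lam M l = Pi_lam M l'.
Proof.
  intros P. destruct (Req_dec (Pi_lam M l) 0) as [E|E].
  - destruct (Req_dec (Pi_lam M l') 0) as [E'|E']; [lra|].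
    destruct (Pi_lam_nonzero _ E') as [N F]. symmetry. now apply Hassign, Permutation_sym.
  - destruct (Pi_lam_nonzero _ E) as [N F]. now apply Hassign.
Qed.

Lemma Forall_prefix {A : Type} (P : A -> Prop) l l' : Forall P (l ++ l') -> Forall P l.
Proof. intros H. now apply Forall_app in H. Qed.

Lemma k_factor_perm pre pre' d :
  Permutation pre pre' -> NoDup (pre ++ holders d) ->
  Forall (fun t => (t < nK M)%nat) (pre ++ holders d) ->
  pprod (k_factor M) pre d = pprod (k_factor M) pre' d.
Proof.
  intros P N F. apply pprod_ext. intros a o c ->. unfold k_factor. f_equal.
  change (o :: c) with ([o] ++ c) in N, F. rewrite !holders_app, !app_assoc in N, F.
  apply Hk_perm.
  - now apply NoDup_app_remove_r in N.
  - now apply Forall_prefix in F.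
  - now do 2 apply Permutation_app_tail.
Qed.

Lemma holders_insert_perm a T c :
  Permutation (holders (a ++ Some T :: c)) (T :: holders (a ++ c)).
Proof. rewrite !holders_app. symmetry. apply Permutation_middle. Qed.

Lemma Permutation_valid (l l' : list nat) : Permutation l l' ->
  NoDup l /\ Forall (fun t => (t < nK M)%nat) l ->
  NoDup l' /\ Forall (fun t => (t < nK M)%nat) l'.
Proof.
  intros P [N F]. split; [now apply Permutation_NoDup with l|].
  now rewrite <- P.
Qed.

Lemma pprod_k_factor_snoc s o :
  pprod (k_factor M) [] (s ++ [o]) = pprod (k_factor M) [] s * / kfun M (holders (s ++ [o])).
Proof. rewrite pprod_app, holders_app. cbn [pprod]. unfold k_factor at 2. cbn [app]. ring. Qed.

(* Order independence enters here: peeling off the last customer, the summand in which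
   the new holder comes last contributes s/k and the others, by induction, the
   complementary fraction. *)
Lemma sum_insertions_k_factor T e :
  headed e -> NoDup (T :: holders e) -> Forall (fun t => (t < nK M)%nat) (T :: holders e) ->
  sumR (cuts e) (fun p => srate M (holders (fst p) ++ [T])
                          * pprod (k_factor M) [] (fst p ++ Some T :: snd p))
  = pprod (k_factor M) [] e.
Proof.
  induction e as [|o e IH] using rev_ind; intros Hh N F.
  - simpl. unfold k_factor. simpl. assert (K : 0 < kfun M [T]) by (apply Hk_pos; easy).
    assert (E := kfun_snoc M [] T). simpl app in E. change (kfun M []) with 0 in E.
    rewrite Rplus_0_l in E. rewrite E in *. field. lra.
  - set (l := holders (e ++ [o])) in *.
    assert (Kne : 0 < kfun M l).
    { inversion N; inversion F; subst. apply Hk_pos; auto.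
      unfold l. intros E. rewrite holders_app in E. apply app_eq_nil in E as [E1 E2].
      destruct o; [discriminate|]. destruct e as [|[]]; [exact Hh|discriminate|exact Hh]. }
    assert (KT : kfun M (T :: l) = kfun M l + srate M (l ++ [T])).
    { rewrite <- kfun_snoc. apply Hk_perm; auto. apply Permutation_cons_append. }
    assert (KTpos : 0 < kfun M (T :: l)) by (apply Hk_pos; easy).
    rewrite cuts_snoc, sumR_app, sumR_map. simpl fst; simpl snd.
    rewrite (sumR_ext (cuts e) _ (fun p => / kfun M (T :: l) *
      (srate M (holders (fst p) ++ [T]) * pprod (k_factor M) [] (fst p ++ Some T :: snd p)))).
    2:{ intros [a c] H. apply in_cuts in H. simpl fst; simpl snd.
        change (a ++ Some T :: c ++ [o]) with (a ++ (Some T :: c) ++ [o]).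
        rewrite app_assoc, pprod_k_factor_snoc.
        rewrite (Hk_perm (T :: l) (holders ((a ++ Some T :: c) ++ [o]))); auto; [ring|].
        unfold l. subst e. rewrite <- !app_assoc. simpl. symmetry.
        apply holders_insert_perm. }
    rewrite sumR_scal, IH; [|now apply headed_app in Hh| |].
    + cbn [sumR fold_right fst snd]. fold l. rewrite !pprod_k_factor_snoc, (holders_app (e ++ [o])).
      fold l. change (holders [Some T]) with [T].
      rewrite <- (Hk_perm (T :: l) (l ++ [T])) by (auto; apply Permutation_cons_append).
      rewrite KT in *. field. split; lra.
    + unfold l in N. rewrite holders_app in N. change (NoDup ((T :: holders e) ++ holders [o])) in N.
      now apply NoDup_app_remove_r in N.
    + unfold l in F. rewrite holders_app in F.
      change (Forall (fun t => (t < nK M)%nat) ((T :: holders e) ++ holders [o])) in F.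
      now apply Forall_prefix in F.
Qed.

Lemma Pi_lam_insert a T c :
  Pi_lam M (holders (a ++ Some T :: c))
  = Pi_lam M (holders (a ++ c)) * lamtok M (holders (a ++ c)) T.
Proof.
  rewrite <- Pi_lam_snoc. apply Pi_lam_perm. rewrite holders_insert_perm.
  apply Permutation_cons_append.
Qed.

Lemma lamU_factor_leave a T c :
  pprod (lamU_factor M) [] (a ++ Some T :: c) * pprod (pass_factor T) (holders a) c
  = pprod (lamU_factor M) [] (a ++ c).
Proof.
  rewrite !pprod_app, Rmult_assoc. f_equal. cbn [pprod app].
  rewrite <- (lamU_factor_pass T (holders a) (holders a ++ holders [Some T]) c).
  - unfold lamU_factor at 1. ring.
  - intros u. rewrite in_app_iff. simpl. tauto.
Qed.

Lemma length_insert {A : Type} (a c : list A) u : length (a ++ u :: c) = S (length (a ++ c)).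
Proof. rewrite !length_app. simpl. lia. Qed.

(** Isolates what depends on the place of insertion: on the right, everything before the last
    parenthesis is a function of [a ++ c] and [T] alone. *)
Lemma leave_weight a T c :
  seq_weight M (a ++ Some T :: c)
  * (eta M (length (a ++ Some T :: c)) * srate M (holders a ++ [T])
     * pprod (pass_factor T) (holders a) c)
  = Pi_lam M (holders (a ++ c)) * lamtok M (holders (a ++ c)) T
    * pprod (lamU_factor M) [] (a ++ c) * eta_factor M (length (a ++ c))
    * (srate M (holders a ++ [T]) * pprod (k_factor M) [] (a ++ Some T :: c)).
Proof.
  unfold seq_weight. rewrite <- (lamU_factor_leave a T c), length_insert,
    <- (eta_factor_S (length (a ++ c))), Pi_lam_insert. ring.
Qed.

Lemma sum_leave_weight T s : headed s ->
  sumR (cuts s) (fun p => seq_weight M (fst p ++ Some T :: snd p)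
    * (eta M (length (fst p ++ Some T :: snd p)) * srate M (holders (fst p) ++ [T])
       * pprod (pass_factor T) (holders (fst p)) (snd p)))
  = lamtok M (holders s) T * seq_weight M s.
Proof.
  intros Hh.
  set (C := Pi_lam M (holders s) * lamtok M (holders s) T
    * pprod (lamU_factor M) [] s * eta_factor M (length s)).
  rewrite (sumR_ext _ _ (fun p => C * (srate M (holders (fst p) ++ [T])
                          * pprod (k_factor M) [] (fst p ++ Some T :: snd p)))).
  2:{ intros [a c] H. apply in_cuts in H. subst s. apply leave_weight. }
  rewrite sumR_scal.
  (* Collapsing the sum needs a valid tuple. If [T] cannot be claimed on top of the holders of [s],
     both sides vanish instead. *)
  destruct (Req_dec (Pi_lam M (holders s ++ [T])) 0) as [E|E].
  - rewrite Pi_lam_snoc in E. unfold C, seq_weight. rewrite E.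
    transitivity ((Pi_lam M (holders s) * lamtok M (holders s) T)
      * (pprod (lamU_factor M) [] s * pprod (k_factor M) [] s * eta_factor M (length s))); [|ring].
    rewrite E. ring.
  - apply Pi_lam_nonzero in E.
    apply (Permutation_valid _ (T :: holders s)) in E; [|symmetry; apply Permutation_cons_append].
    rewrite sum_insertions_k_factor by tauto. unfold C, seq_weight. ring.
Qed.

(** The reclaiming customer has factor lambda_U(l + T), with l the other holders ahead of it.
    Multiplying by one minus the skip probability leaves lambda_U(l + T) - lambda_U(l). The
    customers in [d] see the same set of holders before and after the transition. *)
Lemma lamU_factor_reclaim a T b d :
  pprod (lamU_factor M) [] (a ++ Some T :: b ++ None :: d)
    * (pprod (pass_factor T) (holders a) b * (1 - qskip T (holders (a ++ b))))
  = pprod (lamU_factor M) [] (a ++ b)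
    * (lamU M (holders (a ++ b) ++ [T]) - lamU M (holders (a ++ b)))
    * pprod (lamU_factor M) (holders (a ++ b) ++ [T]) d.
Proof.
  change (a ++ Some T :: b ++ None :: d) with (a ++ (Some T :: b) ++ None :: d).
  rewrite app_assoc, (pprod_app _ _ (a ++ Some T :: b)).
  rewrite <- (lamU_factor_leave a T b). cbn [pprod app].
  set (l := holders (a ++ b)). set (l' := holders (a ++ Some T :: b)).
  assert (P : Permutation l' (T :: l)) by apply holders_insert_perm.
  assert (S1 : forall u, In u l' <-> In u (T :: l)).
  { intros u; split; apply Permutation_in; [exact P|now symmetry]. }
  assert (S2 : forall u, In u (l ++ [T]) <-> In u (T :: l)).
  { intros u. rewrite in_app_iff. simpl. tauto. }
  simpl holders. rewrite app_nil_r. unfold lamU_factor at 2.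
  rewrite (lamU_ext _ _ S1), (lamU_ext _ _ S2), <- (qskip_mult T l).
  replace (pprod (lamU_factor M) l' d) with (pprod (lamU_factor M) (l ++ [T]) d); [ring|].
  apply pprod_ext. intros e [|] f _; [reflexivity|]. apply lamU_ext. intros u.
  rewrite !in_app_iff, S1. simpl. tauto.
Qed.

(** From the reclaiming customer onwards, the two sequences have the same holders up to order, so k
    takes the same values. *)
Lemma k_factor_reclaim a T b d :
  NoDup (holders (a ++ b ++ Some T :: d)) ->
  Forall (fun t => (t < nK M)%nat) (holders (a ++ b ++ Some T :: d)) ->
  pprod (k_factor M) [] (a ++ Some T :: b ++ None :: d)
  = pprod (k_factor M) [] (a ++ Some T :: b)
    * (/ kfun M (holders (a ++ b) ++ [T]) * pprod (k_factor M) (holders (a ++ b) ++ [T]) d).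
Proof.
  intros N F. rewrite app_assoc in N, F.
  change (Some T :: d) with ([Some T] ++ d) in N, F.
  rewrite app_assoc, holders_app, (holders_app _ [Some T]) in N, F.
  change (holders [Some T]) with [T] in N, F.
  change (a ++ Some T :: b ++ None :: d) with (a ++ (Some T :: b) ++ None :: d).
  rewrite app_assoc, (pprod_app _ _ (a ++ Some T :: b)). f_equal. cbn [pprod app].
  assert (P : Permutation (holders (a ++ b) ++ [T]) (holders (a ++ Some T :: b))).
  { rewrite holders_insert_perm. symmetry. apply Permutation_cons_append. }
  simpl holders. unfold k_factor at 1. simpl holders. rewrite !app_nil_r. f_equal.
  - f_equal. symmetry. apply Hk_perm; [|now apply Forall_prefix in F|exact P].
    now apply NoDup_app_remove_r in N.
  - symmetry. now apply k_factor_perm.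
Qed.

(** The predecessors considered here turn the displayed holder of [T] back into a waiting customer
    and insert the departed holder somewhere in [e]. The sum over that place collapses by
    [sum_insertions_k_factor]. *)
Lemma sum_reclaim_weight e T d : headed e ->
  sumR (cuts e) (fun p => seq_weight M (fst p ++ Some T :: snd p ++ None :: d)
    * (eta M (length (fst p ++ Some T :: snd p ++ None :: d)) * srate M (holders (fst p) ++ [T])
       * (pprod (pass_factor T) (holders (fst p)) (snd p)
          * (1 - qskip T (holders (fst p ++ snd p))))))
  = seq_weight M (e ++ Some T :: d)
    * (lamU M (holders e ++ [T]) - lamU M (holders e)).
Proof.
  intros Hh. set (x := e ++ Some T :: d).
  assert (HP : forall a b, e = a ++ b ->
    Pi_lam M (holders (a ++ Some T :: b ++ None :: d)) = Pi_lam M (holders x)).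
  { intros a b ->. apply Pi_lam_perm. unfold x. rewrite !holders_insert_perm.
    rewrite !holders_app, <- app_assoc. reflexivity. }
  destruct (Req_dec (Pi_lam M (holders x)) 0) as [E|E].
  - unfold seq_weight at 2. rewrite E. rewrite sumR_zero; [ring|].
    intros [a b] H. apply in_cuts in H. unfold seq_weight. simpl fst; simpl snd.
    rewrite HP, E by exact H. ring.
  - destruct (Pi_lam_nonzero _ E) as [N F].
    set (C := Pi_lam M (holders x) * (pprod (lamU_factor M) [] e
      * (lamU M (holders e ++ [T]) - lamU M (holders e))
      * pprod (lamU_factor M) (holders e ++ [T]) d) * eta_factor M (length x)
      * (/ kfun M (holders e ++ [T]) * pprod (k_factor M) (holders e ++ [T]) d)).
    rewrite (sumR_ext _ _ (fun p => C * (srate M (holders (fst p) ++ [T])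
                          * pprod (k_factor M) [] (fst p ++ Some T :: snd p)))).
    + rewrite sumR_scal, sum_insertions_k_factor; auto.
      * unfold C, x, seq_weight. rewrite !(pprod_app _ _ e). cbn [pprod app].
        unfold k_factor at 4. unfold lamU_factor at 4. change (holders [Some T]) with [T]. ring.
      * unfold x in N. apply NoDup_app_remove_r with (holders d).
        apply Permutation_NoDup with (2 := N). rewrite holders_insert_perm, holders_app. reflexivity.
      * unfold x in F. apply Forall_prefix with (holders d).
        rewrite holders_insert_perm, holders_app in F. exact F.
    + intros [a b] H. apply in_cuts in H. simpl fst; simpl snd. unfold seq_weight, C.
      rewrite HP by exact H. subst e.
      rewrite <- lamU_factor_reclaim, k_factor_reclaim
        by (unfold x in *; rewrite <- app_assoc in *; assumption).
      (* The predecessor has one customer more than [x], which accounts for the factor eta. *)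
      replace (length (a ++ Some T :: b ++ None :: d)) with (S (length x)).
      2:{ unfold x. repeat (rewrite length_app; simpl). lia. }
      rewrite <- (eta_factor_S (length x)). ring.
Qed.

(** * Flow into a state by departures *)

Lemma indicator_nonzero x y : indicator x y <> 0 -> y = x.
Proof. unfold indicator. destruct (state_eq_dec y x); [auto|lra]. Qed.

Lemma indicator_same x : indicator x x = 1.
Proof. unfold indicator. now destruct (state_eq_dec x x). Qed.

(** With no other holder ahead, a waiting customer cannot skip the freed token in a predecessor of
    nonzero weight. Thus relevant departures never leave a waiting customer at the head, and
    [of_seq] loses nothing. *)
Lemma headed_of_pass a T c :
  pprod (lamU_factor M) [] (a ++ Some T :: c) <> 0 ->
  pprod (pass_factor T) (holders a) c <> 0 -> headed (a ++ c).
Proof.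
  intros H1 H2. apply headed_of_lamU_factor. rewrite <- (lamU_factor_leave a T c).
  now apply Rmult_integral_contrapositive.
Qed.

Lemma Rmult_nonzero r1 r2 : r1 * r2 <> 0 -> r1 <> 0 /\ r2 <> 0.
Proof. split; intros E; apply H; rewrite E; ring. Qed.

Definition rebuild (p : list (option nat) * option nat * list (option nat)) : list (option nat) :=
  fst (fst p) ++ snd (fst p) :: snd p.
Definition rebuild2
    (z : list (option nat) * option nat * (list (option nat) * option nat * list (option nat))) :=
  fst (fst z) ++ snd (fst z) :: rebuild (snd z).
(** Recording the marked position, not only the resulting sequence, keeps the enumeration
    duplicate-free without any validity assumption on [s]. The same holds for [reclaim_preds], whose
    entries with [None] as departing customer contribute zero. *)
Definition leave_preds (s : list (option nat)) :=
  flat_map (fun T => map (fun q => (fst q, Some T, snd q)) (cuts s)) (seq 0 (nK M)).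
Definition reclaim_preds (s : list (option nat)) :=
  flat_map (fun p => map (fun q => (fst q, snd (fst p), (snd q, @None nat, snd p)))
                         (cuts (fst (fst p)))) (pivots s).

Lemma NoDup_leave_preds s : NoDup (leave_preds s).
Proof.
  apply NoDup_flat_map; [apply seq_NoDup| |].
  - intros T _. apply Injective_map_NoDup; [|apply NoDup_cuts].
    intros [a c] [a' c'] [= -> ->]. reflexivity.
  - intros T T' b H H'. apply in_map_iff in H as (q & <- & _).
    apply in_map_iff in H' as (q' & [=] & _). congruence.
Qed.

Lemma NoDup_reclaim_preds s : NoDup (reclaim_preds s).
Proof.
  apply NoDup_flat_map; [apply NoDup_pivots| |].
  - intros p _. apply Injective_map_NoDup; [|apply NoDup_cuts].
    intros [a c] [a' c'] [= -> ->]. reflexivity.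
  - intros [[e o] d] [[e' o'] d'] b H H'. apply in_map_iff in H as ([a c] & <- & H).
    apply in_map_iff in H' as ([a' c'] & [= E1 E2 E3 E4] & H').
    simpl in *. apply in_cuts in H, H'. congruence.
Qed.

(** Both sides become sums over sequences with a marked departing holder. The nonzero terms that
    lead to [x] are those of [leave_preds], where [sum_leave_weight] applies token by token. *)
Lemma leave_inflow x L : NoDup L ->
  (forall p, In p (leave_preds (to_seq x)) -> seq_weight M (rebuild p) <> 0 -> In (rebuild p) L) ->
  sumR L (fun s => sumR (pivots s) (fun p => match p with
    | (a, Some T, c) => seq_weight M (rebuild p)
        * (eta M (length (rebuild p)) * srate M (holders a ++ [T])
           * leave_term (indicator x) a T c)
    | _ => 0 end))
  = sumR (seq 0 (nK M)) (fun T => lamtok M (toks x) T) * weight M x.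
Proof.
  intros N HL. rewrite <- sumR_flat_map, (sumR_support_eq _ (leave_preds (to_seq x))).
  - unfold leave_preds. rewrite sumR_flat_map, Rmult_comm, <- sumR_scal.
    apply sumR_ext. intros T _. rewrite sumR_map.
    rewrite weight_seq_weight, Rmult_comm, <- holders_to_seq, <- sum_leave_weight
      by apply headed_to_seq.
    apply sumR_ext. intros [a c] H. apply in_cuts in H. unfold rebuild, leave_term.
    cbn [fst snd]. rewrite <- H, of_seq_to_seq, indicator_same. ring.
  - apply NoDup_flat_map; [exact N|intros; apply NoDup_pivots|].
    intros s s' [[a u] c] H H'. apply in_pivots in H, H'. congruence.
  - apply NoDup_leave_preds.
  - intros [[a [T|]] c] H E; [|lra]. apply in_flat_map in H as (s & Hs & H).
    apply in_pivots in H. unfold rebuild in E. cbn [fst snd] in E. rewrite <- H in E.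
    apply Rmult_nonzero in E as [E1 E]. apply Rmult_nonzero in E as [_ E].
    apply Rmult_nonzero in E as [E2 E3]. apply indicator_nonzero in E3.
    destruct (seq_weight_nonzero _ E1) as (_ & _ & HF). subst s.
    rewrite <- E3, to_seq_of_seq.
    + apply in_flat_map. exists T. split.
      * apply in_seq. rewrite Forall_forall in HF. specialize (HF T).
        enough (T < nK M)%nat by lia. apply HF.
        apply Permutation_in with (1 := Permutation_sym (holders_insert_perm a T c)). now left.
      * apply in_map_iff. exists (a, c). split; [reflexivity|now apply in_cuts].
    + apply headed_of_pass with T; auto. unfold seq_weight in E1.
      apply Rmult_nonzero in E1 as [E1 _]. apply Rmult_nonzero in E1 as [E1 _].
      now apply Rmult_nonzero in E1.
  - intros p Hp E. specialize (HL p Hp). destruct p as [[a [T|]] c]; [|lra].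
    apply Rmult_nonzero in E as [E _]. apply in_flat_map. eexists.
    split; [exact (HL E)|now apply in_pivots].
Qed.

(** Same scheme as [leave_inflow], with two marks: the departing holder and the customer who takes
    over its token. *)
Lemma reclaim_inflow x L : NoDup L ->
  (forall z, In z (reclaim_preds (to_seq x)) -> seq_weight M (rebuild2 z) <> 0 ->
     In (rebuild2 z) L) ->
  sumR L (fun s => sumR (pivots s) (fun p => match p with
    | (a, Some T, c) => sumR (pivots c) (fun q =>
        seq_weight M (rebuild2 (fst p, q))
        * (eta M (length (rebuild2 (fst p, q))) * srate M (holders a ++ [T])
           * reclaim_term (indicator x) a T q))
    | _ => 0 end))
  = lamU M (toks x) * weight M x.
Proof.
  intros N HL.
  set (f := fun z => match z with
    | (a, Some T, q) => seq_weight M (rebuild2 z)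
        * (eta M (length (rebuild2 z)) * srate M (holders a ++ [T])
           * reclaim_term (indicator x) a T q)
    | _ => 0 end).
  transitivity (sumR (flat_map (fun s => flat_map (fun p =>
     map (fun q => (fst p, q)) (pivots (snd p))) (pivots s)) L) f).
  { rewrite sumR_flat_map. apply sumR_ext. intros s _.
    rewrite sumR_flat_map. apply sumR_ext. intros [[a [T|]] c] _; rewrite sumR_map.
    - reflexivity.
    - now rewrite sumR_zero. }
  rewrite (sumR_support_eq _ (reclaim_preds (to_seq x))).
  - unfold reclaim_preds. rewrite sumR_flat_map, weight_seq_weight, Rmult_comm.
    (* Writing lambda_U as a difference from its zero value at the empty set lets it be split into
       one increment for each holder of [x]. *)
    replace (lamU M (toks x)) with (lamU M (holders (to_seq x)) - lamU M [])
      by (rewrite holders_to_seq, lamU_nil; ring).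
    rewrite <- sumR_pivots_telescope, <- sumR_scal. apply sumR_ext.
    intros [[e [T|]] d] H; rewrite sumR_map; cbn [fst snd f].
    + apply in_pivots in H. assert (Hh := headed_to_seq x). rewrite H in *.
      apply headed_app in Hh. rewrite <- sum_reclaim_weight by exact Hh.
      apply sumR_ext. intros [a b] Hab. apply in_cuts in Hab.
      unfold f, rebuild2, rebuild, reclaim_term. cbn [fst snd].
      rewrite (app_assoc a b (Some T :: d)), <- Hab, <- H, of_seq_to_seq, indicator_same. ring.
    + rewrite sumR_zero; [ring|]. reflexivity.
  - apply NoDup_flat_map; [exact N|intros s _|].
    + apply NoDup_flat_map; [apply NoDup_pivots| |].
      * intros p _. apply Injective_map_NoDup; [|apply NoDup_pivots]. congruence.
      * intros [[a o] c] [[a' o'] c'] z H H'.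
        apply in_map_iff in H as ([[b u] d] & <- & H).
        apply in_map_iff in H' as ([[b' u'] d'] & [= E1 E2 E3 E4 E5] & H').
        simpl in *. apply in_pivots in H, H'. congruence.
    + intros s s' z H H'.
      apply in_flat_map in H as ([[a o] c] & H1 & H). apply in_map_iff in H as ([[b u] d] & <- & H).
      apply in_flat_map in H' as ([[a' o'] c'] & H1' & H').
      apply in_map_iff in H' as ([[b' u'] d'] & [= E1 E2 E3 E4 E5] & H').
      apply in_pivots in H1, H1'. simpl in *. apply in_pivots in H, H'. congruence.
  - apply NoDup_reclaim_preds.
  - intros z H E. apply in_flat_map in H as (s & Hs & H).
    apply in_flat_map in H as ([[a o] c] & Ha & H).
    apply in_map_iff in H as ([[b u] d] & <- & H). cbn [fst snd] in *.
    apply in_pivots in Ha, H. destruct o as [T|]; [|now destruct E].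
    unfold f, rebuild2, rebuild in E. cbn [fst snd] in E. rewrite <- H in E.
    apply Rmult_nonzero in E as [E1 E]. apply Rmult_nonzero in E as [_ E].
    destruct u as [|]; [now destruct E|].
    apply Rmult_nonzero in E as [E2 E3]. apply Rmult_nonzero in E2 as [E2 _].
    apply indicator_nonzero in E3.
    assert (Hh : headed (a ++ b)).
    { subst c.
      change (a ++ Some T :: b ++ None :: d) with (a ++ (Some T :: b) ++ None :: d) in *.
      rewrite app_assoc in E1. apply headed_of_pass with T; auto.
      unfold seq_weight in E1.
      apply Rmult_nonzero in E1 as [E1 _]. apply Rmult_nonzero in E1 as [E1 _].
      apply Rmult_nonzero in E1 as [_ E1]. rewrite pprod_app in E1.
      now apply Rmult_nonzero in E1. }
    rewrite <- E3, to_seq_of_seq.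
    + apply in_flat_map. exists (a ++ b, Some T, d).
      split; [apply in_pivots; now rewrite <- app_assoc|].
      apply in_map_iff. exists (a, b). split; [reflexivity|now apply in_cuts].
    + rewrite app_assoc. destruct (a ++ b) as [|[]]; simpl in *; auto.
  - intros z Hz E. specialize (HL z Hz). destruct z as [[a [T|]] [[b u] d]]; [|now destruct E].
    apply Rmult_nonzero in E as [E _]. apply in_flat_map. eexists.
    split; [exact (HL E)|]. apply in_flat_map. exists (a, Some T, b ++ u :: d).
    split; [now apply in_pivots|]. apply in_map_iff. exists (b, u, d).
    split; [reflexivity|now apply in_pivots].
Qed.

Definition departure_preds (x : state) : list state :=
  map of_seq (map rebuild (leave_preds (to_seq x)) ++ map rebuild2 (reclaim_preds (to_seq x))).

Lemma departure_inflow x L : NoDup L ->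
  (forall y, In y (departure_preds x) -> weight M y <> 0 -> In y L) ->
  sumR L (fun y => weight M y * flow (departures M y) (indicator x))
  = weight M x * flow (arrivals M x) (fun _ => 1).
Proof.
  intros N HL.
  assert (N' : NoDup (map to_seq L)).
  { apply Injective_map_NoDup; [|exact N]. intros y y'. apply to_seq_inj. }
  assert (HL' : forall s, In s (map rebuild (leave_preds (to_seq x))
      ++ map rebuild2 (reclaim_preds (to_seq x))) -> seq_weight M s <> 0 -> In s (map to_seq L)).
  { intros s Hs Hw. destruct (seq_weight_nonzero _ Hw) as (Hh & _).
    rewrite <- (to_seq_of_seq s Hh) in Hw |- *. apply in_map. apply HL.
    - now apply in_map.
    - now rewrite weight_seq_weight. }
  rewrite arrival_flow.
  (* The two summands match the two kinds of departure: arrivals claiming a token balance tokens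
     becoming available, and arrivals joining the queue balance reclaimed tokens. *)
  transitivity (sumR (seq 0 (nK M)) (fun T => lamtok M (toks x) T) * weight M x
    + lamU M (toks x) * weight M x).
  2:{ rewrite (sumR_ext (seq 0 (nK M)) (fun t => lamtok M (toks x) t * 1)
        (fun T => lamtok M (toks x) T)) by (intros; lra). ring. }
  rewrite <- (leave_inflow x _ N'), <- (reclaim_inflow x _ N'), !sumR_map, <- sumR_plus.
  - apply sumR_ext. intros y _. rewrite <- sumR_plus, departure_flow, <- sumR_scal.
    apply sumR_ext. intros [[a [T|]] c] H; [|ring]. apply in_pivots in H.
    rewrite Rmult_plus_distr_l, Rmult_plus_distr_l. f_equal.
    + unfold rebuild. cbn [fst snd]. now rewrite <- H, <- weight_seq_weight, length_to_seq.
    + rewrite <- sumR_scal, <- sumR_scal. apply sumR_ext. intros [[b u] d] Hq.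
      apply in_pivots in Hq. unfold rebuild2, rebuild. cbn [fst snd].
      now rewrite <- Hq, <- H, <- weight_seq_weight, length_to_seq.
  - intros z Hz. apply HL'. apply in_app_iff. right. now apply in_map.
  - intros p Hp. apply HL'. apply in_app_iff. left. now apply in_map.
Qed.

(** * Flow into a state by arrivals *)

Lemma holders_headed_nonempty s o : headed (s ++ [o]) -> holders (s ++ [o]) <> [].
Proof. destruct s as [|[]], o; simpl; easy. Qed.

Lemma seq_weight_step s o : headed (s ++ [o]) ->
  seq_weight M (s ++ [o]) * (eta M (length (s ++ [o])) * kfun M (holders (s ++ [o])))
  = seq_weight M s * (lam_factor M (holders s) o * lamU_factor M (holders s) o).
Proof.
  intros Hh. rewrite seq_weight_snoc, length_app. simpl length. rewrite Nat.add_1_r.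
  assert (He : 0 < eta M (S (length s))) by (apply Heta; lia).
  (* Positivity of k is known only for valid tuples; in the case of a zero product both sides
     vanish, and otherwise the tuple is valid and k cancels. *)
  destruct (Req_dec (seq_weight M s * lam_factor M (holders s) o) 0) as [E|E].
  - rewrite <- (Rmult_assoc (seq_weight M s)), E. ring.
  - apply Rmult_nonzero in E as [E1 E2].
    assert (Hk : 0 < kfun M (holders (s ++ [o]))).
    { apply Hk_pos; [now apply holders_headed_nonempty| |];
        apply Pi_lam_nonzero; rewrite holders_app; intros E.
      all: assert (E3 : Pi_lam M (holders s) * lam_factor M (holders s) o = 0) by
          (destruct o; simpl in *; [now rewrite <- Pi_lam_snoc|rewrite app_nil_r in E; lra]).
      all: apply Rmult_integral in E3 as [E3|E3]; [|contradiction].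
      all: apply E1; unfold seq_weight; rewrite E3; ring. }
    field. split; lra.
Qed.

Lemma lam_factor_nonneg l o : 0 <= lam_factor M l o * lamU_factor M l o.
Proof.
  destruct o as [t|]; simpl; apply Rmult_le_pos;
    first [apply lamtok_nonneg|apply lamU_nonneg|lra].
Qed.

(** A new customer always enters at the end of the sequence, so undoing an arrival removes the last
    one. *)
Definition arrival_pred (x : state) : state := of_seq (removelast (to_seq x)).

Lemma arrival_flow_unique x y : x <> [] ->
  flow (arrivals M y) (indicator x) <> 0 -> y = arrival_pred x.
Proof.
  intros Hx H. destruct (state_eq_dec y (arrival_pred x)) as [E|E]; [exact E|].
  destruct H. rewrite arrival_flow.
  assert (K : forall z o, to_seq z = to_seq y ++ [o] -> indicator x z = 0).
  { intros z o Hz. unfold indicator. destruct (state_eq_dec z x) as [->|]; [|reflexivity].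
    destruct E. unfold arrival_pred. now rewrite Hz, removelast_last, of_seq_to_seq. }
  rewrite sumR_zero.
  - rewrite Rplus_0_l. destruct y as [|e y].
    (* At the empty state [incr_last] adds nobody, so the target is again empty and differs from
       [x]. *)
    + unfold indicator. destruct (state_eq_dec _ x) as [E'|_]; [now destruct Hx|apply Rmult_0_r].
    + rewrite (K _ None); [ring|]. now apply to_seq_incr_last.
  - intros t _. rewrite (K _ (Some t)); [ring|]. now rewrite to_seq_app.
Qed.

Lemma arrival_flow_pred s o : headed (s ++ [o]) ->
  flow (arrivals M (of_seq s)) (indicator (of_seq (s ++ [o])))
  = lam_factor M (holders s) o * lamU_factor M (holders s) o.
Proof.
  intros Hh. assert (Hs : headed s) by now apply headed_app in Hh.
  rewrite arrival_flow, <- holders_to_seq, to_seq_of_seq, of_seq_snoc by exact Hs.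
  set (y := of_seq s). destruct o as [t|]; cbn [lam_factor lamU_factor].
  - rewrite (sumR_single _ _ t).
    (* Queueing cannot lead to the same state: its sequence is empty or ends with a waiting customer
       instead of a holder. *)
    + rewrite indicator_same. unfold indicator.
      destruct (state_eq_dec (incr_last y) _) as [E|_]; [|ring].
      apply (f_equal to_seq) in E. destruct y as [|e y'] eqn:Ey; [discriminate|].
      rewrite to_seq_incr_last, to_seq_app in E by easy.
      now apply app_inj_tail in E.
    + apply seq_NoDup.
    + intros t' _ H. apply Rmult_nonzero in H as [_ H]. apply indicator_nonzero in H.
      apply app_inj_tail in H as [_ H]. congruence.
    + intros H. apply Rmult_nonzero in H as [H _]. apply lamtok_nonzero in H.
      apply in_seq. lia.
  - rewrite indicator_same, sumR_zero; [ring|]. intros t _.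
    unfold indicator. destruct (state_eq_dec _ _) as [E|_]; [|ring].
    apply (f_equal to_seq) in E. rewrite to_seq_app, to_seq_incr_last in E.
    + now apply app_inj_tail in E.
    + intros Ey. apply (f_equal to_seq) in Ey. unfold y in Ey.
      rewrite to_seq_of_seq in Ey by exact Hs. simpl in Ey. subst s. exact Hh.
Qed.

(** A nonempty [x] receives arrivals only from [arrival_pred x], and [seq_weight_step] is the
    balance along that single edge. For the empty state both sides are zero. *)
Lemma arrival_inflow x L : NoDup L ->
  (weight M (arrival_pred x) <> 0 -> In (arrival_pred x) L) ->
  sumR L (fun y => weight M y * flow (arrivals M y) (indicator x))
  = weight M x * flow (departures M x) (fun _ => 1).
Proof.
  intros N HL. rewrite departure_outflow.
  destruct x as [|e x'].
  - change (kfun M (toks [])) with 0. rewrite sumR_zero; [ring|].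
    intros y _. rewrite arrival_flow, sumR_zero.
    + destruct y as [|e y]; [simpl; rewrite lamU_nil; ring|].
      unfold indicator. destruct (state_eq_dec _ _) as [E|_]; [|ring].
      apply (f_equal to_seq) in E. rewrite to_seq_incr_last in E by easy.
      now destruct (to_seq (e :: y)).
    + intros t _. unfold indicator.
      destruct (state_eq_dec _ _) as [E|_]; [now destruct y|ring].
  - set (x := e :: x') in *. assert (Hx : to_seq x <> []) by (destruct e; discriminate).
    destruct (exists_last Hx) as (s & o & Hs).
    assert (Hh : headed (s ++ [o])) by (rewrite <- Hs; apply headed_to_seq).
    assert (Ep : arrival_pred x = of_seq s)
      by (unfold arrival_pred; now rewrite Hs, removelast_last).
    rewrite (sumR_single L _ (arrival_pred x) N).
    + rewrite !weight_seq_weight, <- length_to_seq, <- holders_to_seq, Ep, Hs,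
        to_seq_of_seq by now apply headed_app in Hh.
      rewrite seq_weight_step, <- arrival_flow_pred by exact Hh.
      now rewrite <- Hs, of_seq_to_seq.
    + intros y _ H. apply arrival_flow_unique; [discriminate|].
      now apply Rmult_nonzero in H.
    + intros H. now apply HL; apply Rmult_nonzero in H.
Qed.

(** A finite list that contains every source of inflow into [x] of nonzero weight, which reduces
    balance on an infinite state space to finite sums. *)
Definition preds (x : state) : list state := arrival_pred x :: departure_preds x.

(* Partial balance: departures from x match arrivals into x, and arrivals at x match
   departures into x. *)
Lemma global_balance x L : NoDup L ->
  (forall y, In y (preds x) -> weight M y <> 0 -> In y L) ->
  sumR L (fun y => weight M y * rate M y x) = weight M x * outrate M x.
Proof.
  intros N HL. rewrite outrate_flow, Rmult_plus_distr_l.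
  rewrite <- (departure_inflow x L N), <- (arrival_inflow x L N), <- sumR_plus.
  - apply sumR_ext. intros y _. rewrite rate_flow. ring.
  - apply HL. now left.
  - intros y Hy. apply HL. now right.
Qed.

(** * Nonnegative rates, positive weights and reachability *)

Lemma arrival_flow_nonneg y F : (forall z, 0 <= F z) -> 0 <= flow (arrivals M y) F.
Proof.
  intros HF. rewrite arrival_flow. apply Rplus_le_le_0_compat.
  - apply sumR_nonneg. intros t _. apply Rmult_le_pos; [apply lamtok_nonneg|apply HF].
  - apply Rmult_le_pos; [apply lamU_nonneg|apply HF].
Qed.

Lemma departure_flow_nonneg y F : (forall z, 0 <= F z) -> 0 <= flow (departures M y) F.
Proof.
  intros HF. rewrite departure_flow. apply sumR_nonneg.
  assert (HP : forall T l s, 0 <= pprod (pass_factor T) l s).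
  { intros T l s. apply pprod_nonneg. intros q [|]; simpl; [lra|apply qskip_bounds]. }
  intros [[a [T|]] c] H; [|lra]. apply in_pivots in H.
  repeat apply Rmult_le_pos.
  - left. apply Heta. rewrite <- length_to_seq, H, length_insert. lia.
  - apply Hs_nonneg.
  - apply Rplus_le_le_0_compat.
    + unfold leave_term. apply Rmult_le_pos; [apply HP|apply HF].
    + apply sumR_nonneg. intros [[b [u|]] d] _; simpl; [lra|].
      repeat apply Rmult_le_pos; [apply HP| |apply HF].
      assert (Q := qskip_bounds T (holders (a ++ b))). lra.
Qed.

Lemma indicator_nonneg x z : 0 <= indicator x z.
Proof. unfold indicator. destruct (state_eq_dec z x); lra. Qed.

Lemma rate_nonneg y x : 0 <= rate M y x.
Proof.
  rewrite rate_flow. apply Rplus_le_le_0_compat;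
    [apply arrival_flow_nonneg|apply departure_flow_nonneg]; apply indicator_nonneg.
Qed.

Lemma weight_nonneg x : 0 <= weight M x.
Proof. rewrite weight_seq_weight. apply seq_weight_nonneg. Qed.

Lemma weight_nil : weight M [] = 1.
Proof. unfold weight, Pi_lam, Pi_k. simpl. field. Qed.

(* Balance spreads positivity along transitions, so no separate invariant for the
   reachable states is needed. *)
Lemma reach_weight_pos x : reach M x -> 0 < weight M x.
Proof.
  induction 1 as [|y x _ IH Hr]; [rewrite weight_nil; lra|].
  destruct (weight_nonneg x) as [H|H]; [exact H|exfalso].
  (* Adding [y] to the list makes its own term part of the sum, so it is bounded by the total, which
     is zero. *)
  assert (B := global_balance x (nodup state_eq_dec (y :: preds x))
    (NoDup_nodup _ _)).
  rewrite <- H, Rmult_0_l in B.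
  assert (P : 0 < weight M y * rate M y x) by now apply Rmult_lt_0_compat.
  rewrite <- B in P.
  - apply (Rlt_irrefl (weight M y * rate M y x)). eapply Rle_lt_trans; [|exact P].
    apply (sumR_member_le _ (fun y => weight M y * rate M y x)).
    + intros z _. apply Rmult_le_pos; [apply weight_nonneg|apply rate_nonneg].
    + apply nodup_In. now left.
  - intros z Hz _. apply nodup_In. now right.
Qed.

(** The state is built by letting its customers arrive one by one in order; a positive weight forces
    each of these arrival rates to be positive. *)
Lemma weight_pos_reach x : 0 < weight M x -> reach M x.
Proof.
  remember (length (to_seq x)) as n eqn:Hn. revert x Hn.
  induction n as [|n IH]; intros x Hn Hw.
  - assert (x = []) as ->; [|constructor]. destruct x as [|[t m] x]; [reflexivity|discriminate].
  - assert (Hx : to_seq x <> []) by (intros E; rewrite E in Hn; discriminate).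
    destruct (exists_last Hx) as (s & o & Hs).
    assert (Hh : headed (s ++ [o])) by (rewrite <- Hs; apply headed_to_seq).
    assert (Hh' : headed s) by now apply headed_app in Hh.
    rewrite weight_seq_weight, Hs, seq_weight_snoc in Hw.
    assert (NZ := Rgt_not_eq _ _ Hw). apply Rmult_nonzero in NZ as [NZ _].
    apply Rmult_nonzero in NZ as [NZ _]. rewrite Rmult_assoc in NZ.
    apply Rmult_nonzero in NZ as [NZ1 NZ2].
    apply reach_step with (of_seq s).
    + apply IH.
      * rewrite to_seq_of_seq by exact Hh'. rewrite Hs, length_app in Hn. simpl in Hn. lia.
      * rewrite weight_seq_weight, to_seq_of_seq by exact Hh'.
        destruct (seq_weight_nonneg s); [assumption|congruence].
    + rewrite rate_flow, <- (of_seq_to_seq x), Hs, arrival_flow_pred by exact Hh.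
      assert (0 <= flow (departures M (of_seq s)) (indicator (of_seq (s ++ [o]))))
        by (apply departure_flow_nonneg, indicator_nonneg).
      destruct (lam_factor_nonneg (holders s) o); [lra|congruence].
Qed.

Lemma reach_iff_weight_pos x : reach M x <-> 0 < weight M x.
Proof. split; [apply reach_weight_pos|apply weight_pos_reach]. Qed.

Lemma reach_tuple_state x : reach M x -> tuple_state M x.
Proof.
  intros H. apply reach_weight_pos in H. rewrite weight_seq_weight in H.
  apply Rgt_not_eq, seq_weight_nonzero in H as (_ & H). now rewrite holders_to_seq in H.
Qed.

Lemma reach_dec x : {reach M x} + {~ reach M x}.
Proof.
  destruct (Rlt_dec 0 (weight M x)) as [H|H]; [left|right]; now rewrite reach_iff_weight_pos.
Qed.

End Dynamics.

(** * Unordered sums *)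

Lemma sumR_incl_le {A : Type} (eqd : forall a b : A, {a = b} + {a <> b})
    (l l' : list A) (f : A -> R) :
  NoDup l -> NoDup l' -> incl l l' -> (forall a, In a l' -> 0 <= f a) ->
  sumR l f <= sumR l' f.
Proof.
  intros N N' I Hf.
  set (r := filter (fun a => if in_dec eqd a l then false else true) l').
  assert (Hr : forall a, In a r <-> In a l' /\ ~ In a l).
  { intros a. unfold r. rewrite filter_In. destruct (in_dec eqd a l); intuition discriminate. }
  rewrite (sumR_perm l' (l ++ r)).
  - rewrite sumR_app. assert (0 <= sumR r f); [|lra].
    apply sumR_nonneg. intros a Ha. apply Hf. now apply Hr.
  - apply NoDup_Permutation; [exact N'| |].
    + apply NoDup_app; [exact N|now apply NoDup_filter|]. intros a Ha Hb. apply Hr in Hb. tauto.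
    + intros a. rewrite in_app_iff, Hr. destruct (in_dec eqd a l); firstorder.
Qed.

(** Any partial sum can be enlarged to contain the relevant part of [C], where it equals [S]. The
    supremum is therefore attained. *)
Lemma nnsum_of_finite {A : Type} (eqd : forall a b : A, {a = b} + {a <> b})
    (P : A -> Prop) (Pdec : forall a, {P a} + {~ P a}) (f : A -> R) (C : list A) (S : R) :
  (forall a, P a -> 0 <= f a) ->
  (forall L, NoDup L -> (forall a, In a C -> P a -> In a L) -> sumR L f = S) ->
  nnsum P f S.
Proof.
  intros Hf HC.
  set (ext := fun L => nodup eqd (L ++ filter (fun a => if Pdec a then true else false) C)).
  assert (Hext : forall L, Forall P L -> Forall P (ext L)).
  { intros L F. rewrite Forall_forall in *. intros a Ha. apply nodup_In, in_app_iff in Ha.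
    destruct Ha as [Ha|Ha]; [now apply F|]. apply filter_In in Ha as [_ Ha].
    destruct (Pdec a); [assumption|discriminate]. }
  assert (Hsum : forall L, sumR (ext L) f = S).
  { intros L. apply HC; [apply NoDup_nodup|]. intros a Ha Pa.
    apply nodup_In, in_app_iff. right. apply filter_In. split; [exact Ha|].
    now destruct (Pdec a). }
  split.
  - intros r (L & N & F & ->). rewrite <- (Hsum L).
    apply (sumR_incl_le eqd); [exact N|apply NoDup_nodup| |].
    + intros a Ha. apply nodup_In, in_app_iff. now left.
    + intros a Ha. apply Hf. specialize (Hext L F). rewrite Forall_forall in Hext. now apply Hext.
  - intros b Hb. rewrite <- (Hsum []). apply Hb. exists (ext []).
    split; [apply NoDup_nodup|split; [apply Hext; constructor|reflexivity]].
Qed.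

(** Transfers summability from all tuple states to the reachable ones: the old sum bounds the new
    partial sums, and completeness gives their supremum. *)
Lemma nnsum_subset {A : Type} (P Q : A -> Prop) (f : A -> R) (S : R) :
  (forall a, P a -> Q a) -> nnsum Q f S -> exists Z, nnsum P f Z.
Proof.
  intros I [HS _]. destruct (completeness
    (fun r => exists L : list A, NoDup L /\ Forall P L /\ r = sumR L f)) as [Z HZ].
  - exists S. intros r (L & N & F & ->). apply HS. exists L. repeat split; [exact N|].
    now apply (Forall_impl Q) in F.
  - exists 0, []. repeat split; constructor.
  - now exists Z.
Qed.

Lemma nnsum_scale {A : Type} (P : A -> Prop) (f : A -> R) (S c : R) :
  0 < c -> nnsum P f S -> nnsum P (fun a => f a * c) (S * c).
Proof.
  intros Hc [HU HL].
  assert (E : forall L, sumR L (fun a => f a * c) = sumR L f * c).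
  { intros L. rewrite Rmult_comm, <- sumR_scal. apply sumR_ext. intros; ring. }
  split.
  - intros r (L & N & F & ->). rewrite E. apply Rmult_le_compat_r; [lra|].
    apply HU. now exists L.
  - intros b Hb. apply Rmult_le_reg_r with (/ c); [now apply Rinv_0_lt_compat|].
    rewrite Rmult_assoc, Rinv_r, Rmult_1_r by lra. apply HL.
    intros r (L & N & F & ->). apply Rmult_le_reg_r with c; [exact Hc|].
    rewrite Rmult_assoc, Rinv_l, Rmult_1_r, <- E by lra. apply Hb. now exists L.
Qed.

(** * Stationary distribution on the reachable states *)

Theorem mainTheorem1 (M : model)
                                                                              
  (Hlam : forall c, (c < nC M)%nat -> 0 < lam M c)
  (Hcompat : forall c, (c < nC M)%nat -> exists t, (t < nK M)%nat /\ compat M c t = true)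
                                  
  (Hp_nonneg : forall c Rs t, 0 <= assign M c Rs t)
  (Hp_supp : forall c Rs t, assign M c Rs t <> 0 ->
       (t < nK M)%nat /\ compat M c t = true /\ ~ In t Rs)
  (Hp_sum : forall c Rs, (c < nC M)%nat ->
       (exists t, (t < nK M)%nat /\ compat M c t = true /\ ~ In t Rs) ->
       sumR (seq 0 (nK M)) (assign M c Rs) = 1)
  (Hp_set : forall c Rs1 Rs2 t, (forall u, In u Rs1 <-> In u Rs2) ->
       assign M c Rs1 t = assign M c Rs2 t)
                            
  (Hassign : forall l1 l2, NoDup l1 -> Forall (fun t => (t < nK M)%nat) l1 ->
       Permutation l1 l2 -> Pi_lam M l1 = Pi_lam M l2)
                                   
  (Hs_nonneg : forall l, 0 <= srate M l)
  (Hk_perm : forall l1 l2, NoDup l1 -> Forall (fun t => (t < nK M)%nat) l1 ->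
       Permutation l1 l2 -> kfun M l1 = kfun M l2)
  (Hk_pos : forall l, l <> [] -> NoDup l -> Forall (fun t => (t < nK M)%nat) l ->
       0 < kfun M l)
  (Heta : forall m, (1 <= m)%nat -> 0 < eta M m)
                                                    
  (Hsum : exists S, nnsum (tuple_state M) (weight M) S) :
  exists Z, 0 < Z /\ nnsum (reach M) (weight M) Z /\
    let pi := fun x => weight M x / Z in
    (forall x, reach M x -> 0 <= pi x) /\
    nnsum (reach M) pi 1 /\
    (forall x, reach M x ->
       nnsum (reach M) (fun y => pi y * rate M y x) (pi x * outrate M x)).
Proof.
  assert (Hiff : forall x, reach M x <-> 0 < weight M x)
    by (intros x; now apply reach_iff_weight_pos).
  destruct Hsum as [S HS].
  destruct (nnsum_subset (reach M) (tuple_state M) (weight M) S) as [Z HZ];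
    [intros x; now apply reach_tuple_state|exact HS|].
  assert (Zpos : 0 < Z).
  (* The constant 1 is the weight of the empty state, which is reachable. *)
  { apply Rlt_le_trans with 1; [lra|]. apply HZ. exists [[]].
    repeat split; [repeat constructor; simpl; tauto|repeat constructor|].
    simpl. rewrite weight_nil. ring. }
  assert (Zinv : 0 < / Z) by now apply Rinv_0_lt_compat.
  assert (Hw : forall x, 0 <= weight M x) by (intros x; now apply weight_nonneg).
  exists Z. split; [exact Zpos|split; [exact HZ|]]. cbv zeta. unfold Rdiv.
  split; [|split].
  - intros x _. apply Rmult_le_pos; [apply Hw|lra].
  - replace 1 with (Z * / Z) by (field; lra). now apply nnsum_scale.
  - intros x _. apply (nnsum_of_finite state_eq_dec) with (C := preds M x).
    + intros y. now apply reach_dec.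
    + intros y _. apply Rmult_le_pos; [|now apply rate_nonneg].
      apply Rmult_le_pos; [apply Hw|lra].
    + intros L N HL.
      rewrite (sumR_ext L _ (fun y => / Z * (weight M y * rate M y x))) by (intros; ring).
      rewrite sumR_scal, global_balance; auto; [ring|].
      (* The list is only known to contain the reachable predecessors; those of nonzero weight are
         reachable. *)
      intros y Hy Hnz. apply HL; [exact Hy|]. apply Hiff.
      destruct (Hw y); [assumption|congruence].
Qed.
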